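(* Consider the parametric volatility model described in the context, with $\Theta$ a compact parameter set. Assume that (ST) the process $(X_t)$ satisfying the model exists and is stationary, non anticipative and ergodic with finite logarithmic moments; (CI) the maps $\phi_t$ satisfy $\Lambda(\phi_t(\cdot,\theta))\le\Lambda_{\phi_t}(\theta)$ for a stationary sequence $(\Lambda_{\phi_t})$ of continuous functions $\Theta\to\mathbb R^+$, and there is a positive integer $r$ such that $\mathbb E[\log\Lambda^{(r)}_{\phi_0}(\theta)]<0$ for every $\theta\in\Theta$; moreover $\mathbb E[\sup_{\Theta}\log^+\Lambda^{(r)}_{\phi_0}(\theta)]<\infty$ and there exists $y\in E$ such that $\mathbb E[\sup_{\Theta}\log^+ d(\phi_0(y,\theta),y)]<\infty$. Then the functions $g_t(\cdot)$ are continuous on $\Theta$ for all $t\in\mathbb Z$. Moreover, for any $\theta\in\Theta$ there exists $\epsilon>0$ such that $\hat g_t$ satisfying $$(\hat g_k(\theta'))_{t-p+1\le k\le t}=\phi_t((\hat g_k(\theta'))_{t-p\le k\le t-1},\theta'),\qquad t\ge 1,$$ with arbitrary initial values $(\hat g_k(\theta'))_{1-p\le k\le 0}$, satisfies $$\sup_{\theta'\in\overline B(\theta,\epsilon)\cap\Theta}d(\hat g_t(\theta'),g_t(\theta'))\xrightarrow{\text{e.a.s.}}0\qquad (t\to\infty).$$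
   Context: Model. $(Z_t)_{t\in\mathbb Z}$ is a stationary ergodic sequence of real random vectors, $\mathcal F_t=\sigma(Z_t,Z_{t-1},\ldots)$, and $X_t=\Sigma_t^{1/2}Z_t$ with invertible square volatility matrices $\Sigma_t$. $h$ is an injective map from the space of real matrices of that size to a separable metric space $F$, and for some true parameter $\theta_0$ the volatilities satisfy a recursion $(h(\Sigma_k))_{k\le t}=\psi_t((h(\Sigma_k))_{k\le t-1},\theta_0)$ with $\psi_t$ an $\mathcal F_{t-1}$-measurable random map. Expressing the innovations through the observations, the recursion is rewritten with a finite number $p$ of lags as $(h(\Sigma_k))_{t-p+1\le k\le t}=\phi_t((h(\Sigma_k))_{t-p\le k\le t-1},\theta_0)$, where $(\phi_t)$ is a stationary ergodic sequence of random maps $\phi_t:E\times\Theta\to E$, each $\phi_t$ being generated by finitely many past observations $(X_{t-1},\ldots,X_{t-q})$. The state space $E$ is the product of $p$ copies of the image of $h$, a complete separable metric space for a product metric $d$ (e.g. $p^{-1}\sum_j d(x_j,y_j)$ or $(\sum_j d^2(x_j,y_j))^{1/2}$) built from the metric, also written $d$, of $F$. Non anticipative means that the solution at time $t$ is a function of $(Z_t,Z_{t-1},\ldots)$. Finite logarithmic moments means $\mathbb E[\log^+\|X_0\|]<\infty$ and $\mathbb E[\log^+ d(y,(h(\Sigma_k))_{1-p\le k\le 0})]<\infty$ for all $y\in E$. $\Lambda(f)=\sup_{x\ne y}d(f(x),f(y))/d(x,y)$ is the Lipschitz coefficient of $f:E\to E$. $\phi_t^{(r)}(\cdot,\theta)=\phi_t(\cdot,\theta)\circ\phi_{t-1}(\cdot,\theta)\circ\cdots\circ\phi_{t-r+1}(\cdot,\theta)$,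 and $\Lambda^{(r)}_{\phi_t}:\Theta\to\mathbb R^+$ denotes a (random) continuous function with $\Lambda(\phi_t^{(r)}(\cdot,\theta))\le\Lambda_{\phi_t}^{(r)}(\theta)$ for all $\theta$, stationary in $t$ ($\Lambda^{(1)}_{\phi_t}=\Lambda_{\phi_t}$). $g_t(\theta)$, $t\in\mathbb Z$, denotes the unique stationary solution of $(g_k(\theta))_{t-p+1\le k\le t}=\phi_t((g_k(\theta))_{t-p\le k\le t-1},\theta)$, $t\in\mathbb Z$, which exists for each $\theta\in\Theta$ under (CI). $\overline B(\theta,\epsilon)$ is the closed ball centered at $\theta$ with radius $\epsilon$. $D_t\xrightarrow{\text{e.a.s.}}0$ means $D_t=o(e^{-Ct})$ a.s. as $t\to\infty$ for some $C>0$.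
   Formalization: Added: each map φ_t(x,·) is continuous on Θ (otherwise g_t may be discontinuous); the p−1 older coordinates of φ_t(x,θ) are those of x, shifted; the arbitrary initial values are a.s. bounded over the ball (otherwise the supremum may be infinite). Continuity of g_t is a.s., for a version. *)

(* Defs.v *)
From HB Require Import structures.
From mathcomp Require Import all_boot all_order all_algebra.
From mathcomp Require Import all_classical all_reals all_analysis.

Set Implicit Arguments.
Unset Strict Implicit.
Unset Printing Implicit Defensive.

Import Order.TTheory GRing.Theory Num.Theory.
Import numFieldNormedType.Exports.
Local Open Scope classical_set_scope.
Local Open Scope ring_scope.

(* Measurability is relative to a system [G] of generating sets of the
   state space (the open sets for the Borel sigma-algebra, evaluation
   cylinders for random maps). *)
Definition random_element (Omega S : Type) (H : set_system Omega)
    (G : set_system S) (Y : Omega -> S) : Prop :=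
  forall B, G B -> H (Y @^-1` B).

Definition sigma_of (Omega S I : Type) (G : set_system S) (J : set I)
    (Y : I -> Omega -> S) : set_system Omega :=
  <<s [set A | exists i B, [/\ J i, G B & A = Y i @^-1` B]] >>.

Definition path_sigma (S : Type) (G : set_system S) : set_system (int -> S) :=
  <<s [set C | exists k B, G B /\ C = [set z | B (z k)]] >>.

Definition shift (S : Type) (z : int -> S) : int -> S := fun k => z (k + 1).

Section processes.
Context {d : measure_display} {Omega : measurableType d} {R : realType}.
Variable P : probability Omega R.

Definition random_sequence (S : Type) (G : set_system S)
    (Y : int -> Omega -> S) : Prop :=
  forall t, random_element measurable G (Y t).

Definition path_event (S : Type) (Y : int -> Omega -> S)
    (A : set (int -> S)) : set Omega := [set w | A (Y ^~ w)].

Definition stationary (S : Type) (G : set_system S)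
    (Y : int -> Omega -> S) : Prop :=
  random_sequence G Y /\
  forall A, path_sigma G A ->
    P (path_event Y A) = P (path_event Y (@shift S @^-1` A)).

Definition ergodic (S : Type) (G : set_system S)
    (Y : int -> Omega -> S) : Prop :=
  forall A, path_sigma G A -> @shift S @^-1` A = A ->
    P (path_event Y A) = 0%E \/ P (path_event Y A) = 1%E.

(* Exponentially fast almost sure convergence to 0. *)
Definition eas_to0 (D : nat -> Omega -> \bar R) : Prop :=
  exists2 C : R, 0 < C &
    \forall w \ae P,
      ((expR (C * n%:R))%:E * D n w)%E @[n --> \oo] --> (0%E : \bar R).

End processes.

Definition psd (R : realType) (n : nat) (A : 'M[R]_n) : Prop :=
  A^T = A /\ forall v : 'cV[R]_n, 0 <= (v^T *m A *m v) 0 0.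

Definition is_sqrtmx (R : realType) (n : nat) (S A : 'M[R]_n) : Prop :=
  psd S /\ S *m S = A.

Definition logp (R : realType) (x : R) : \bar R := maxe (lne x%:E) 0%E.

Definition separable (T : topologicalType) : Prop :=
  exists2 D : set T, countable D & dense D.

Section state_space.
Context {R : realType} {F : metricType R} {M : Type}.

Definition img (h : M -> F) : Type := set_type (range h).

Definition to_img (h : M -> F) (A : M) : img h :=
  exist _ (h A) (mem_set (imageT h A)).

Definition img_dist (h : M -> F) (u v : img h) : R :=
  mdist (\val u : F) (\val v : F).

Definition img_open (h : M -> F) : set_system (img h) :=
  [set B | exists2 U : set F, open U & B = [set u | U (\val u)]].

Definition state (p : nat) (h : M -> F) : Type := 'I_p -> img h.

(* [(u_k)_{t-p+1 <= k <= t}], oldest entry first. *)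
Definition window (p : nat) (h : M -> F) (u : int -> img h) (t : int) :
    state p h :=
  fun j => u (t - p%:Z + 1 + (nat_of_ord j)%:Z).

(* A product metric is [N (d x_0 y_0, ..., d x_{p-1} y_{p-1})] for a norm [N]
   on R^p that is monotone on the nonnegative orthant; this covers all the
   (weighted) l^1, l^2 and sup combinations. *)
Definition product_metric (p : nat) (h : M -> F)
    (dE : state p h -> state p h -> R) : Prop :=
  exists N : 'rV[R]_p -> R,
    [/\ forall a b : 'rV[R]_p, N (a + b) <= N a + N b,
        forall (c : R) (a : 'rV[R]_p), N (c *: a) = `|c| * N a,
        forall a : 'rV[R]_p, N a = 0 -> a = 0,
        forall a b : 'rV[R]_p, (forall j, 0 <= a 0 j <= b 0 j) -> N a <= N b &
        forall x y, dE x y = N (\row_j img_dist (x j) (y j))].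

End state_space.

Section metric_functions.
Context {R : realType} {E : Type}.
Variable dE : E -> E -> R.

Definition dist_complete : Prop :=
  forall u : nat -> E,
    (forall e, 0 < e -> exists m, forall i j, (m <= i)%N -> (m <= j)%N ->
       dE (u i) (u j) < e) ->
    exists l, dE (u n) l @[n --> \oo] --> 0.

Definition dist_separable : Prop :=
  exists2 D : set E, countable D &
    forall x e, 0 < e -> exists2 y, D y & dE x y < e.

Definition lip_coef (f : E -> E) : \bar R :=
  ereal_sup [set (dE (f z.1) (f z.2) / dE z.1 z.2)%:E | z in
    [set z : E * E | z.1 <> z.2]].

End metric_functions.

(* [phi_t \o phi_{t-1} \o ... \o phi_{t-r+1}] *)
Fixpoint iter_maps (E : Type) (f : int -> E -> E) (r : nat) (t : int) : E -> E :=
  if r is r'.+1 then f t \o iter_maps f r' (t - 1) else id.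

Section model.
Context {d : measure_display} {Omega : measurableType d} {R : realType}.
Variable P : probability Omega R.
Context {n : nat} {F T : metricType R}.
Variables (h : 'M[R]_n -> F) (Theta : set T).

Definition past_sigma (Z : int -> Omega -> 'cV[R]_n) (t : int) :
    set_system Omega :=
  sigma_of open [set s : int | s <= t] Z.

(* [psi_t] acts on sequences indexed by the lag: [s j] is the value at
   time [t - j]. *)
Record volatility_model (theta0 : T) (Z X : int -> Omega -> 'cV[R]_n)
    (Sigma : int -> Omega -> 'M[R]_n)
    (psi : int -> Omega -> (nat -> img h) -> T -> (nat -> img h)) : Prop := {
  innov_stationary : stationary P open Z ;
  innov_ergodic : ergodic P open Z ;
  vol_invertible : \forall w \ae P, forall t, Sigma t w \in unitmx ;
  observationE : \forall w \ae P, forall t,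
    exists2 S, is_sqrtmx S (Sigma t w) & X t w = S *m Z t w ;
  psi_predictable : forall t s theta j, Theta theta ->
    random_element (past_sigma Z (t - 1)) (@img_open _ _ _ h)
      (fun w => psi t w s theta j) ;
  vol_recursion : \forall w \ae P, forall t,
    (fun j : nat => to_img h (Sigma (t - j%:Z) w)) =
    psi t w (fun j : nat => to_img h (Sigma (t - 1 - j%:Z) w)) theta0 }.

(* The law of a random map E x Theta -> E is taken on the sigma-algebra
   generated by the evaluations at points of E x Theta. *)
Definition map_cylinders (p : nat) : set_system (state p h -> T -> state p h) :=
  [set C | exists x theta (j : 'I_p) B,
    [/\ Theta theta, @img_open _ _ _ h B & C = [set f | B (f x theta j)]]].

Definition fun_cylinders : set_system (T -> R) :=
  [set C | exists theta B,
    [/\ Theta theta, measurable B & C = [set f | B (f theta)]]].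

Definition obs_sigma (X : int -> Omega -> 'cV[R]_n) (q : nat) (t : int) :
    set_system Omega :=
  sigma_of open [set s : int | t - q%:Z <= s <= t - 1] X.

(* [lag_maps_shift] is forced by the overlap of the windows on the two sides
   of the p-lag recursion, which must be solvable from any initial values. *)
Record lag_model (p q : nat) (theta0 : T) (X : int -> Omega -> 'cV[R]_n)
    (Sigma : int -> Omega -> 'M[R]_n)
    (phi : int -> Omega -> state p h -> T -> state p h) : Prop := {
  lag_maps_stationary : stationary P (map_cylinders (p := p)) phi ;
  lag_maps_ergodic : ergodic P (map_cylinders (p := p)) phi ;
  lag_maps_observed : forall t,
    random_element (obs_sigma X q t) (map_cylinders (p := p)) (phi t) ;
  lag_maps_continuous : forall t w x j,
    {within Theta, continuous (fun theta => \val (phi t w x theta j) : F)} ;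
  lag_maps_shift : forall t w x theta (i j : 'I_p), Theta theta ->
    nat_of_ord j = i.+1 -> phi t w x theta i = x j ;
  lag_recursion : \forall w \ae P, forall t,
    window (fun k => to_img h (Sigma k w)) t =
    phi t w (window (fun k => to_img h (Sigma k w)) (t - 1)) theta0 }.

Record cond_ST (p : nat) (dE : state p h -> state p h -> R)
    (Z X : int -> Omega -> 'cV[R]_n) (Sigma : int -> Omega -> 'M[R]_n) :
    Prop := {
  ST_stationary : stationary P open X ;
  ST_ergodic : ergodic P open X ;
  ST_nonanticipative : forall t,
    random_element (past_sigma Z t) open (X t) /\
    random_element (past_sigma Z t) (@img_open _ _ _ h)
      (fun w => to_img h (Sigma t w)) ;
  ST_logmoment_obs : (\int[P]_w logp `|X 0%R w| < +oo)%E ;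
  ST_logmoment_vol : forall y : state p h,
    (\int[P]_w logp (dE y (window (fun k => to_img h (Sigma k w)) 0%R)) < +oo)%E }.

(* [Lam r t w theta] stands for Lambda^{(r)}_{phi_t}(theta). *)
Record lipschitz_bounds (p : nat) (dE : state p h -> state p h -> R)
    (phi : int -> Omega -> state p h -> T -> state p h)
    (Lam : nat -> int -> Omega -> T -> R) : Prop := {
  lip_stationary : forall r, (0 < r)%N -> stationary P fun_cylinders (Lam r) ;
  lip_continuous : forall r t w, (0 < r)%N ->
    {within Theta, continuous (Lam r t w)} ;
  lip_ge0 : forall r t w theta, (0 < r)%N -> Theta theta ->
    0 <= Lam r t w theta ;
  lip_bound : forall r t w theta, (0 < r)%N -> Theta theta ->
    (lip_coef dE (iter_maps (fun s x => phi s w x theta) r t) <=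
     (Lam r t w theta)%:E)%E }.

Record cond_CI (p : nat) (dE : state p h -> state p h -> R)
    (phi : int -> Omega -> state p h -> T -> state p h)
    (Lam : nat -> int -> Omega -> T -> R) : Prop := {
  CI_bounds : lipschitz_bounds dE phi Lam ;
  CI_contraction : exists2 r : nat, (0 < r)%N &
    (forall theta, Theta theta ->
      (\int[P]_w lne (Lam r 0%R w theta)%:E < 0)%E) /\
    (\int[P]_w ereal_sup [set logp (Lam r 0%R w theta) | theta in Theta]
      < +oo)%E ;
  CI_logmoment : exists y : state p h,
    (\int[P]_w ereal_sup [set logp (dE (phi 0%R w y theta) y) | theta in Theta]
      < +oo)%E }.

Definition stationary_solution (p : nat)
    (phi : int -> Omega -> state p h -> T -> state p h) (theta : T)
    (u : int -> Omega -> img h) : Prop :=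
  stationary P (@img_open _ _ _ h) u /\
  \forall w \ae P, forall t,
    window (u ^~ w) t = phi t w (window (u ^~ w) (t - 1)) theta.

(* Uniqueness is up to almost sure equality. *)
Definition unique_stationary_solution (p : nat)
    (phi : int -> Omega -> state p h -> T -> state p h) (theta : T)
    (u : int -> Omega -> img h) : Prop :=
  stationary_solution phi theta u /\
  forall v, stationary_solution phi theta v ->
    \forall w \ae P, forall t, v t w = u t w.

Definition closed_ball_in (theta : T) (e : R) : set T :=
  [set theta' | Theta theta' /\ mdist theta theta' <= e].

(* The initial values may depend on the parameter and on chance; they only
   have to be bounded on [K], as otherwise the supremum over [K] of the
   initial error is infinite. *)
Definition approx_recursion (p : nat) (dE : state p h -> state p h -> R)
    (phi : int -> Omega -> state p h -> T -> state p h) (K : set T)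
    (ghat : int -> T -> Omega -> img h) : Prop :=
  (\forall w \ae P, forall t : int, 1 <= t -> forall theta, K theta ->
     window (fun k => ghat k theta w) t =
     phi t w (window (fun k => ghat k theta w) (t - 1)) theta) /\
  (\forall w \ae P, exists (y : state p h) (m : R), forall theta, K theta ->
     dE y (window (fun k => ghat k theta w) 0) <= m).

End model.

(* Main.v *)
Require Import Defs.
From HB Require Import structures.
From mathcomp Require Import all_boot all_order all_algebra.
From mathcomp Require Import all_classical all_reals all_analysis.
From mathcomp Require Import measurable_realfun.
From mathcomp Require Import ring lra zify.
Import Order.TTheory GRing.Theory Num.Theory.
Import numFieldNormedType.Exports.
Local Open Scope classical_set_scope.
Local Open Scope ring_scope.

Set Implicit Arguments.
Unset Strict Implicit.
Unset Printing Implicit Defensive.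

(** The backward iterates [phi_t o ... o phi_(t-k+1) (y)] converge, because the
    maps contract exponentially along almost every path; their limit is the
    stationary solution, and for the same reason two solutions driven by the
    same maps merge exponentially fast.

    The bounds of the contraction condition are stationary, but they need not
    be ergodic, nor jointly stationary with the maps. Their means are used only
    to see that the true Lipschitz coefficients [sup_lip] of the [r]-fold
    compositions, taken over a small ball of parameters, have a negative
    logarithmic mean ([contraction_ball]). These coefficients are functionals
    of the path of [phi], since by continuity the suprema run over countable
    dense sets ([sup_lip_measurable]), so that the ergodicity of [phi] applies
    to them. The path system is realized on pairs (time, chance)
    ([orbit_space]), where shifting the time is invertible, preserves the law
    and is ergodic.

    The ergodic theorem ([birkhoff_mean]) controls averages over all times,
    whereas composing blocks of [r] maps only sees one residue class modulo
    [r], and the [r]-th power of the shift need not be ergodic. The chain of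
    blocks therefore changes class once: [glued_chain_decay] follows the given
    class to a nearby time at which fewer than [r] maps compose to something of
    bounded Lipschitz coefficient, and continues from there in the class with
    the smallest cost, which is at most the average cost. This gives
    exponential decay with a deterministic rate for a submultiplicative
    cocycle whose [r]-step values have a negative logarithmic mean
    ([cocycle_decay]). It is applied over the backward shift, for the
    convergence of the backward iterates uniformly over the ball
    ([contracting_ball]), and over the forward shift, for the distance between
    an arbitrary recursion and the stationary one ([approx_recursion_eas]).

    Continuity in the parameter comes from the uniform convergence
    ([volatility_continuous]). For uniqueness, a second stationary solution is
    compared with the backward iterates: its value at time [t - k] is tight in
    [k], hence bounded along a subsequence, while the Lipschitz coefficient of
    [k] maps tends to [0] ([stationary_solution_unique]). *)

(** * Averages of real sequences and chains of blocks *)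

(** The averages of [u] tend to [m]. An error of the form [K + e n] on the sums
    adds up without divisions and has no exceptional small [n]. *)
Definition mean_to (R : realType) (u : nat -> R) (m : R) : Prop :=
  forall e, 0 < e -> exists K, forall n,
    `|\sum_(k < n) u k - m * n%:R| <= K + e * n%:R.

Section gluing.
Context {R : realType}.
Implicit Types (u : nat -> R) (e : R).

Lemma mean_to_ub u m : mean_to u m -> forall e, 0 < e ->
  exists2 K, 0 <= K & forall n, \sum_(k < n) u k <= m * n%:R + K + e * n%:R.
Proof.
move=> um e e0; have [K HK] := um e e0.
exists `|K|; first exact: normr_ge0.
move=> n; have := HK n; rewrite ler_norml => /andP[_ H].
have := ler_norm K; lra.
Qed.

Lemma mean_to_lb u m : mean_to u m -> forall e, 0 < e ->
  exists2 K, 0 <= K & forall n, m * n%:R - K - e * n%:R <= \sum_(k < n) u k.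
Proof.
move=> um e e0; have [K HK] := um e e0.
exists `|K|; first exact: normr_ge0.
move=> n; have := HK n; rewrite ler_norml => /andP[H _].
have := ler_norm K; lra.
Qed.

Lemma mean_to_term u m : mean_to u m -> forall e, 0 < e ->
  exists2 K, 0 <= K & forall n, `|u n| <= K + e * n%:R.
Proof.
move=> um e e0; have e20 : 0 < e / 2 by rewrite divr_gt0.
have [K HK] := um _ e20.
exists (`|K| *+ 2 + `|m| + e).
  by rewrite !addr_ge0 ?mulrn_wge0 ?normr_ge0 ?ltW.
move=> n; have H0 := HK n; have := HK n.+1.
rewrite big_ord_recr /= -natr1 => H1.
move: H0 H1; rewrite !ler_norml => /andP[a1 a2] /andP[b1 b2].
have k1 := ler_norm K; have m1 := ler_norm m.
have m2 := ler_norm (- m); rewrite normrN in m2.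
have n0 : 0 <= n%:R :> R by [].
apply/andP; split; lra.
Qed.

Lemma sum_window_shift (x : nat -> R) r s : (0 < r)%N ->
  \sum_(i < r) x (s.+1 + i)%N = \sum_(i < r) x (s + i)%N + x (s + r)%N - x s.
Proof.
case: r => // r _; rewrite [in LHS]big_ord_recr [in RHS]big_ord_recl /=.
rewrite addn0 addSnnS.
have -> : \sum_(i < r) x (s + bump 0 i)%N = \sum_(i < r) x (s.+1 + i)%N.
  by apply: eq_bigr => i _; rewrite /bump /= add1n addSnnS.
by ring.
Qed.

(** Here [x j] is the cost of a chain of blocks inside the residue class of [j].
    Any [r] consecutive times meet each class once, so that their costs add up
    to the sum of all of [b], whatever its average along a single class. *)
Lemma sum_window_classes r (A : R) b (x : nat -> R) : (0 < r)%N ->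
  (forall j, (j < r)%N -> x j = A) -> (forall j, x (j + r)%N = x j + b j) ->
  forall s, \sum_(i < r) x (s + i)%N = r%:R * A + \sum_(k < s) b k.
Proof.
move=> r0 xA xb; elim=> [|s IH].
  rewrite big_ord0 addr0 (eq_bigr (fun=> A)); last first.
    by move=> i _; rewrite add0n xA.
  by rewrite sumr_const card_ord mulr_natl.
rewrite sum_window_shift // IH big_ord_recr /= xb; ring.
Qed.

Lemma class_cost_exists r (A : R) b : (0 < r)%N -> exists x : nat -> R,
  (forall j, (j < r)%N -> x j = A) /\ (forall j, x (j + r)%N = x j + b j).
Proof.
move=> r0.
exists (fun j => A + \sum_(l < j %/ r) b (j %% r + l * r)%N); split.
  by move=> j jr; rewrite divn_small // big_ord0 addr0.
move=> j; rewrite divnDr ?dvdnn // divnn r0 addn1 modnDr big_ord_recr /= addrA.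
by congr (_ + _ + b _); rewrite addnC -divn_eq.
Qed.

Lemma min_le_average r (x : nat -> R) (B : R) : (0 < r)%N ->
  \sum_(i < r) x i <= r%:R * B -> exists2 i, (i < r)%N & x i <= B.
Proof.
move=> r0 H; apply: contrapT => h.
suff: \sum_(i < r) B < \sum_(i < r) x i.
  by rewrite sumr_const card_ord -mulr_natl ltNge H.
apply: ltr_sum => [|i _]; first by apply/hasP; exists (Ordinal r0);
  rewrite // mem_index_enum.
by rewrite ltNge; apply/negP => xi; apply: h; exists i.
Qed.

Lemma sum_nat_mono (u : nat -> R) : (forall k, 0 <= u k) ->
  forall i j, (i <= j)%N -> \sum_(k < i) u k <= \sum_(k < j) u k.
Proof.
move=> u0 i j ij; rewrite -(subnKC ij) big_split_ord /= lerDl.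
exact: sumr_ge0.
Qed.

(** A set of times of frequency at most [1 / (2 r)] cannot contain all the
    points of one residue class modulo [r] in a window of length proportional
    to [n] that ends at [n]. *)
Lemma good_time_in_class r (bad : nat -> bool) (p e : R) :
  (0 < r)%N -> 0 < e -> 0 <= p -> p * (2 * r%:R) <= 1 ->
  mean_to (fun k => (bad k)%:R) p ->
  exists n0, forall n a q, (n0 <= n)%N -> n = (a + r * q)%N ->
    e * n%:R <= q%:R -> exists2 l, (l < q)%N & ~~ bad (a + r * l)%N.
Proof.
move=> r0 e0 p0 pr bp; have e8 : 0 < e / 8 by rewrite divr_gt0.
have [K1 K10 H1] := mean_to_ub bp e8; have [K2 K20 H2] := mean_to_lb bp e8.
exists (Num.trunc (4 * (K1 + K2) / e)).+1 => n a q n0n nE qe.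
apply: contrapT => h.
have allbad l : (l < q)%N -> bad (a + r * l)%N.
  by move=> lq; apply/negPn/negP => nb; apply: h; exists l.
pose S j := \sum_(k < j) (bad k)%:R : R.
have S_mono : {homo S : i j / (i <= j)%N >-> i <= j}.
  by move=> i j; apply: (sum_nat_mono (u := fun k => (bad k)%:R)).
have step m : (m <= q)%N -> S a + m%:R <= S (a + r * m)%N.
  elim: m => [|m IH] mq; first by rewrite muln0 addn0 addr0.
  apply: (@le_trans _ _ (S (a + r * m).+1)); last first.
    by apply: S_mono; clear -r0; nia.
  rewrite /S big_ord_recr /= (allbad m mq) -natr1 addrA lerD2r.
  by apply: IH; exact: ltnW.
have := step q (leqnn q); rewrite -nE => Sq.
have Sn : S n <= p * n%:R + K1 + e / 8 * n%:R := H1 n.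
have Sa : p * a%:R - K2 - e / 8 * a%:R <= S a := H2 a.
have nE' : n%:R = a%:R + r%:R * q%:R :> R by rewrite nE natrD natrM.
have an : a%:R <= n%:R :> R by rewrite ler_nat nE leq_addr.
have pq : p * (r%:R * q%:R) <= q%:R / 2.
  have := ler_wpM2r (ler0n R q) pr; lra.
have ean : e / 8 * a%:R <= e / 8 * n%:R by rewrite ler_wpM2l // ltW.
have nK : 4 * (K1 + K2) < e * n%:R.
  rewrite [e * _]mulrC -ltr_pdivrMr //; apply: (lt_le_trans (truncnS_gt _)).
  by rewrite ler_nat.
have p1 : p * n%:R = p * a%:R + p * (r%:R * q%:R) by rewrite nE' mulrDr.
lra.
Qed.

Lemma block_cost r (c : nat -> nat -> R) (b : nat -> R) :
  (0 < r)%N -> (forall i j, 0 <= c i j) ->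
  (forall i j k, (i <= j <= k)%N -> c i k <= c i j * c j k) ->
  (forall k, c k (k + r)%N <= expR (b k)) ->
  forall a l, (0 < l)%N -> c a (a + r * l)%N <=
    expR (\sum_(k < a + r * l) Num.max (b k) 0 - \sum_(k < a) Num.max (b k) 0).
Proof.
move=> r0 c0 cM cb a l; case: l => // l _.
have b0 k : 0 <= Num.max (b k) 0 by rewrite le_max lexx orbT.
have stepb j : expR (b j) <= expR (\sum_(k < j + r) Num.max (b k) 0 -
    \sum_(k < j) Num.max (b k) 0).
  rewrite ler_expR.
  apply: (@le_trans _ _ (\sum_(k < j.+1) Num.max (b k) 0 -
    \sum_(k < j) Num.max (b k) 0)).
    by rewrite big_ord_recr /= addrAC subrr add0r le_max lexx.
  by rewrite lerD2r; apply: (sum_nat_mono (u := fun k =>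
    Num.max (b k) 0)) => //; clear -r0; lia.
elim: l => [|l IH]; first by rewrite muln1; apply: le_trans (cb a) (stepb a).
have -> : (a + r * l.+2 = a + r * l.+1 + r)%N by clear; lia.
apply: (le_trans (cM a (a + r * l.+1)%N _ _)); first by rewrite !leq_addr.
apply: (le_trans (ler_pM (c0 _ _) (c0 _ _) IH (le_trans (cb _) (stepb _)))).
rewrite -expRD ler_expR; lra.
Qed.

Lemma exp_decay_of_eventually (C L : R) (n0 : nat) (u : nat -> R) :
  (forall n, (n0 <= n)%N -> u n <= expR (L - C * n%:R)) ->
  (forall n, 0 <= u n) ->
  exists2 K, 0 <= K & forall n, u n <= K * expR (- (C * n%:R)).
Proof.
move=> H u0; pose K := \sum_(k < n0) u k * expR (C * k%:R).
have K0 : 0 <= K by apply: sumr_ge0 => i _; rewrite mulr_ge0 // expR_ge0.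
exists (expR L + K); first by rewrite addr_ge0 // expR_ge0.
move=> n; rewrite mulrDl -expRD; case: (leqP n0 n) => nn.
  by apply: (le_trans (H n nn)); rewrite lerDl mulr_ge0 // expR_ge0.
apply: (@le_trans _ _ (K * expR (- (C * n%:R))));
  last by rewrite lerDr expR_ge0.
rewrite -ler_pdivrMr ?expR_gt0 // -expRN opprK.
rewrite /K (bigD1 (Ordinal nn)) //= lerDl; apply: sumr_ge0 => i _.
by rewrite mulr_ge0 // expR_ge0.
Qed.

(** Chaining only the blocks of one residue class modulo [r] would require
    the average of [b] along that class to be negative. Here the chain
    follows the class of [n] down to a good time [s] close to [n], at a cost
    controlled by the positive part of [b], and changes there to the cheapest
    of the [r] classes, whose average cost is at most that of all of [b]. *)
Lemma glued_chain_decay r (c : nat -> nat -> R) (b : nat -> R)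
    (bad : nat -> bool) (g beta p kappa : R) :
  (0 < r)%N -> (forall i j, 0 <= c i j) ->
  (forall i j k, (i <= j <= k)%N -> c i k <= c i j * c j k) ->
  (forall k, c k (k + r)%N <= expR (b k)) ->
  0 < g -> mean_to b (- g) ->
  0 <= beta -> mean_to (fun k => Num.max (b k) 0) beta ->
  0 <= p -> p * (2 * r%:R) <= 1 -> mean_to (fun k => (bad k)%:R) p ->
  (forall k, ~~ bad k -> forall i, (i < r)%N ->
     c (k + r - i)%N (k + r)%N <= expR kappa) ->
  exists2 K, 0 <= K &
    forall n, c 0%N n <= K * expR (- (g / (4 * r%:R) * n%:R)).
Proof.
move=> r0 c0 cM cb g0 bg beta0 bbeta p0 pr badp good.
have rR : 1 <= r%:R :> R by rewrite ler1n.
have rR0 : 0 < r%:R :> R by rewrite ltr0n.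
(* [e] bounds the relative length of the detour to a good time, and [eta] the
   error in the averages: together they cost at most half of [g / (2 r)]. *)
pose w := 8 * r%:R * (g / 2 + beta * r%:R) + 2 * r%:R * g.
have w0 : 0 < w.
  rewrite /w ltr_wpDl // ?mulr_gt0 // !mulr_ge0 // addr_ge0 ?mulr_ge0 //; lra.
pose e := g / w; have e0 : 0 < e by rewrite divr_gt0.
have ew : e * w = g by rewrite /e divfK // gt_eqF.
pose eta := g / (16 * r%:R).
have eta0 : 0 < eta by rewrite divr_gt0 // mulr_gt0.
have [n1 Hgood] := good_time_in_class r0 e0 p0 pr badp.
have [K1 K10 H1] := mean_to_ub bg eta0.
have [K2 K20 H2] := mean_to_ub bbeta eta0.
have [K3 K30 H3] := mean_to_lb bbeta eta0.
pose A := \sum_(j < r) c 0%N j.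
have cA j : (j < r)%N -> c 0%N j <= expR A.
  move=> jr; apply: (@le_trans _ _ A).
    by rewrite /A (bigD1 (Ordinal jr)) //= lerDl; apply: sumr_ge0.
  by apply: le_trans (expR_ge1Dx A); rewrite lerDr.
have [x [xA xb]] := class_cost_exists A b r0.
have cx j : c 0%N j <= expR (x j).
  elim/ltn_ind: j => j IH; case: (ltnP j r) => jr.
    by rewrite (xA j jr); exact: cA.
  rewrite -(subnK jr) xb expRD; apply: (le_trans (cM 0%N (j - r)%N _ _));
    first by rewrite leq_addr.
  by apply: ler_pM => //; apply: IH; rewrite ltn_subrL r0 (leq_trans r0 jr).
pose L := kappa + A + K1 / r%:R + g / 2 + beta * r%:R + K2 + K3.
apply: (@exp_decay_of_eventually _ L (maxn n1 (2 * r)%N) (c 0%N)) => // n.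
rewrite geq_max => /andP[n1n rn].
pose q := (Num.trunc (e * n%:R)).+1.
have en0 : 0 <= e * n%:R by rewrite mulr_ge0 // ltW.
have /andP[q1 q2] := truncn_itv en0.
have q1' : q%:R <= e * n%:R + 1 by rewrite /q -natr1 lerD2r.
have er : e * (2 * r%:R) <= 1.
  rewrite -(ler_pM2r g0) mul1r -mulrA.
  apply: (@le_trans _ _ (e * w)); last by rewrite ew.
  apply: ler_wpM2l; first exact: ltW.
  rewrite /w lerDr !mulr_ge0 // addr_ge0 ?mulr_ge0 //; lra.
have rqn : (r * q <= n)%N.
  rewrite -(ler_nat R) natrM.
  apply: (le_trans (ler_wpM2l (ltW rR0) q1')).
  have : (2 * r)%:R <= n%:R :> R by rewrite ler_nat.
  rewrite natrM => rn'; have := ler_wpM2r (ler0n R n) er; lra.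
pose a := (n - r * q)%N.
have nE : n = (a + r * q)%N by rewrite /a subnK.
have [l lq nb] := Hgood n a q n1n nE (ltW q2).
pose k := (a + r * l)%N.
have kE : (k + r = a + r * l.+1)%N by rewrite /k mulnS [(r + _)%N]addnC addnA.
(* The [r] times up to the good time [k + r] lie in distinct classes. *)
have [i ir xi] : exists2 i, (i < r)%N &
    x (k.+1 + i)%N <= A + (\sum_(j < k.+1) b j) / r%:R.
  apply: min_le_average => //; rewrite (sum_window_classes r0 xA xb).
  by rewrite mulrDr mulrC [r%:R * (_ / _)]mulrC divfK ?gt_eqF // mulrC.
pose j := (k.+1 + i)%N; pose s := (k + r)%N.
have js : (j <= s)%N by rewrite /j /s addSnnS leq_add2l.
have sn : (s <= n)%N by rewrite /s kE nE leq_add2l leq_pmul2l.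
have cjs : c j s <= expR kappa.
  have -> : j = (k + r - (r - i.+1))%N by rewrite /j; clear -ir; lia.
  by apply: good => //; clear -ir; lia.
pose B m := \sum_(k < m) Num.max (b k) 0.
have Bmono : {homo B : i j / (i <= j)%N >-> i <= j}.
  by move=> i1 j1; apply: (sum_nat_mono (u := fun k => Num.max (b k) 0)) => m;
    rewrite le_max lexx orbT.
have csn : c 0%N n <= expR (x j) * expR kappa * expR (B n - B a).
  have c0s : c 0%N s <= expR (x j) * expR kappa.
    apply: (le_trans (cM 0%N j s js)).
    exact: ler_pM.
  move: sn; rewrite leq_eqVlt => /orP[/eqP <-|sn].
    apply: (le_trans c0s); rewrite ler_peMr ?mulr_ge0 ?expR_ge0 //.
    by rewrite -expR0 ler_expR subr_ge0; apply: Bmono; rewrite /s kE leq_addr.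
  apply: (le_trans (cM 0%N s n (ltnW sn))).
  apply: ler_pM => //.
  have snE : n = (s + r * (q - l.+1))%N.
    by rewrite /s kE nE -addnA -mulnDr subnKC.
  rewrite {1}snE; apply: (le_trans (block_cost r0 c0 cM cb s _)).
    by case: (q - l.+1)%N snE sn => // ->; rewrite muln0 addn0 ltnn.
  rewrite ler_expR -snE lerD2l lerN2; apply: Bmono; rewrite /s kE;
    exact: leq_addr.
apply: (le_trans csn); rewrite -!expRD ler_expR.
have HB : B n - B a <= beta * (r%:R * q%:R) + K2 + K3 + 2 * eta * n%:R.
  have := H2 n; have := H3 a; rewrite -/(B a) -/(B n) => h3 h2.
  have an : eta * a%:R <= eta * n%:R.
    by rewrite ler_wpM2l ?(ltW eta0) // ler_nat nE leq_addr.
  have : beta * n%:R = beta * a%:R + beta * (r%:R * q%:R).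
    by rewrite nE natrD natrM mulrDr.
  lra.
have bq : beta * (r%:R * q%:R) <= beta * r%:R * (e * n%:R + 1).
  by rewrite -mulrA; apply: ler_wpM2l => //; apply: ler_wpM2l; first exact: ltW.
have Hx : x j <= A + K1 / r%:R - (g / 2) * k.+1%:R / r%:R.
  apply: (le_trans xi); rewrite -addrA lerD2l -mulrBl ler_pM2r ?invr_gt0 //.
  have := H1 k.+1; have : eta <= g / 2.
    rewrite /eta ler_pM2l // lef_pV2 ?posrE ?mulr_gt0 //; lra.
  move=> /(ler_wpM2r (ler0n R k.+1)); lra.
have Hk : g / 2 * (n%:R - r%:R * q%:R) / r%:R <= g / 2 * k.+1%:R / r%:R.
  rewrite ler_pM2r ?invr_gt0 //; apply: ler_wpM2l; first lra.
  rewrite lerBlDr -natrM -natrD ler_nat nE leq_add2r /k.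
  by rewrite leqW // leq_addr.
have Hk2 : g / 2 * (n%:R - r%:R * q%:R) / r%:R =
    g / (4 * r%:R) * n%:R + g / (8 * r%:R) * n%:R + g / (8 * r%:R) * n%:R -
    g / 2 * q%:R.
  by field; rewrite gt_eqF.
have Hq : g / 2 * q%:R <= g / 2 * (e * n%:R + 1) by rewrite ler_wpM2l //; lra.
have He : (e * (g / 2 + beta * r%:R)) * n%:R <= g / (8 * r%:R) * n%:R.
  apply: ler_wpM2r => //; rewrite ler_pdivlMr ?mulr_gt0 //.
  apply: (@le_trans _ _ (e * w)); last by rewrite ew.
  have -> : e * w = e * (g / 2 + beta * r%:R) * (8 * r%:R) + e * (2 * r%:R * g).
    by rewrite /w; ring.
  rewrite lerDl; apply: mulr_ge0; first exact: ltW.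
  by apply: mulr_ge0; [exact: mulr_ge0|exact: ltW].
have Heta : 2 * eta = g / (8 * r%:R) by rewrite /eta; field; rewrite gt_eqF.
have g1 : g / 2 * (e * n%:R + 1) = e * (g / 2) * n%:R + g / 2 by ring.
have g2 : beta * r%:R * (e * n%:R + 1) =
  e * (beta * r%:R) * n%:R + beta * r%:R by ring.
rewrite Heta in HB; rewrite g1 in Hq; rewrite g2 in bq.
rewrite mulrDr mulrDl in He.
rewrite /L; lra.
Qed.

End gluing.

(** * The ergodic theorem *)

Section measure_preserving_maps.
Context {d : measure_display} {S : measurableType d} {R : realType}.
Variable mu : probability S R.

Definition measure_preserving (tau : S -> S) : Prop :=
  measurable_fun setT tau /\
  forall A, measurable A -> mu (tau @^-1` A) = mu A.

Definition ergodic_map (tau : S -> S) : Prop :=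
  forall A, measurable A -> tau @^-1` A = A -> mu A = 0%E \/ mu A = 1%E.

Lemma integrable_mfun (f : S -> R) :
  mu.-integrable setT (EFin \o f) -> measurable_fun setT f.
Proof. by move=> /integrableP[/measurable_EFinP]. Qed.

Lemma EFin_Rintegral (f : S -> R) : mu.-integrable setT (EFin \o f) ->
  (\int[mu]_s (f s)%:E)%E = (\int[mu]_s f s)%:E.
Proof. by move=> fi; rewrite /Rintegral fineK //;
  apply: integrable_fin_num. Qed.

Lemma Rintegral_const (c : R) : \int[mu]_s c = c.
Proof.
rewrite Rintegral_cst //; transitivity (c * 1); last exact: mulr1.
congr (_ * _); exact: (congr1 fine (probability_setT mu)).
Qed.

Lemma integrable_const (c : R) : mu.-integrable setT (EFin \o (fun=> c)).
Proof. exact: finite_measure_integrable_cst. Qed.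

Variable tau : S -> S.
Hypothesis tau_mp : measure_preserving tau.

Lemma ae_comp (Q : S -> Prop) :
  (\forall s \ae mu, Q s) -> \forall s \ae mu, Q (tau s).
Proof.
case=> N [mN muN QN]; exists (tau @^-1` N); split.
- by rewrite -[X in measurable X]setTI; apply: tau_mp.1.
- by rewrite tau_mp.2.
- by move=> s /= nQ; apply: QN.
Qed.

Lemma ae_iter (Q : S -> Prop) :
  (\forall s \ae mu, Q s) -> \forall s \ae mu, forall n, Q (iter n tau s).
Proof.
move=> aQ; apply: ae_foralln => n.
by elim: n => [//|n IH]; have := ae_comp IH; apply: filterS => s;
  rewrite -iterSr.
Qed.

Lemma integrable_comp (f : S -> R) : mu.-integrable setT (EFin \o f) ->
  mu.-integrable setT (EFin \o (f \o tau)).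
Proof.
move=> /integrableP[mf fi]; apply/integrableP; split.
  apply/measurable_EFinP; apply: measurableT_comp; last exact: tau_mp.1.
  exact/measurable_EFinP.
have mnf : measurable_fun setT (fun s => `|(f s)%:E|%E).
  exact: measurableT_comp.
have := @ge0_integral_pushforward _ _ _ _ _ _ tau_mp.1 mu setT
  (fun s => `|(f s)%:E|%E) measurableT mnf (fun _ _ => abse_ge0 _).
rewrite preimage_setT => /= <-.
by rewrite (@eq_measure_integral _ _ _ setT mu) //;
  [exact: tau_mp.1|move=> ? A mA _; exact: tau_mp.2].
Qed.

Lemma Rintegral_comp (f : S -> R) : mu.-integrable setT (EFin \o f) ->
  \int[mu]_s f (tau s) = \int[mu]_s f s.
Proof.
move=> fi; congr fine.
have mf : measurable_fun setT (EFin \o f) by case/integrableP : fi.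
have := @integral_pushforward _ _ _ _ _ _ tau_mp.1 mu setT (EFin \o f) mf.
rewrite preimage_setT => /(_ (integrable_comp fi) measurableT) /= <-.
by rewrite (@eq_measure_integral _ _ _ setT mu) //;
  [exact: tau_mp.1|move=> ? A mA _; exact: tau_mp.2].
Qed.

Fixpoint max_partial_sum (f : S -> R) (n : nat) (s : S) : R :=
  if n is m.+1 then Num.max 0 (f s + max_partial_sum f m (tau s)) else 0.

Lemma max_partial_sum_ge0 f n s : 0 <= max_partial_sum f n s.
Proof. by case: n => [|n] //=; rewrite le_max lexx. Qed.

Lemma sum_le_max_partial_sum f n s :
  \sum_(k < n) f (iter k tau s) <= max_partial_sum f n s.
Proof.
elim: n s => [|n IH] s; first by rewrite big_ord0.
rewrite big_ord_recl /= le_max; apply/orP; right; rewrite lerD2l.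
apply: le_trans (IH (tau s)); apply: ler_sum => k _.
by rewrite -iterSr.
Qed.

Lemma max_partial_sum_mono f n s :
  max_partial_sum f n s <= max_partial_sum f n.+1 s.
Proof.
elim: n s => [|n IH] s; first exact: max_partial_sum_ge0.
rewrite [leRHS]/= [leLHS]/=; apply: le_max2 => //; rewrite lerD2l; exact: IH.
Qed.

Lemma max_partial_sum_integrable f n : mu.-integrable setT (EFin \o f) ->
  mu.-integrable setT (EFin \o max_partial_sum f n).
Proof.
move=> fi; elim: n => [|n IH]; first exact: integrable0.
have mfM : measurable_fun setT (fun s => f s + max_partial_sum f n (tau s)).
  apply: measurable_funD; apply: integrable_mfun => //; exact: integrable_comp.
apply: (@le_integrable _ _ _ mu setT measurableT _
  (EFin \o (fun s => f s + max_partial_sum f n (tau s)))).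
- by apply/measurable_EFinP; apply: measurable_maxr => //;
    exact: measurable_cst.
- move=> s _ /=; rewrite lee_fin ger0_norm ?le_max ?lexx //.
  by rewrite ge_max normr_ge0 ler_norm.
- rewrite (_ : _ \o _ = ((EFin \o f) \+ (EFin \o (max_partial_sum f n \o
    tau)))%E) //.
  by apply: integrableD => //; exact: integrable_comp.
Qed.

Lemma measurable_gt (f : S -> R) (a : R) : measurable_fun setT f ->
  measurable [set s | a < f s].
Proof.
move=> mf; rewrite (_ : [set s | _] = setT `&` f @^-1` `]a, +oo[%classic).
  by apply: mf => //; exact: measurable_itv.
by rewrite setTI; apply/seteqP; split=> s /=; rewrite in_itv /= andbT.
Qed.

Hypothesis tau_ergodic : ergodic_map tau.

(** Where the running maxima of the partial sums of [f] are unbounded, they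
    satisfy [M_{n+1} - M_n \o tau = max (- M_n \o tau, f) --> f]. The left-hand
    side has a nonnegative integral, because [M_n] increases and [tau]
    preserves [mu], and that set is invariant; hence it can only have full
    measure if the integral of [f] is nonnegative. *)
Lemma sums_bounded_above f : mu.-integrable setT (EFin \o f) ->
  \int[mu]_s f s < 0 ->
  \forall s \ae mu, exists K, forall n, \sum_(k < n) f (iter k tau s) <= K.
Proof.
move=> fi f_neg; pose M := max_partial_sum f.
have Mi n : mu.-integrable setT (EFin \o M n) by apply:
  max_partial_sum_integrable.
have mM n : measurable_fun setT (M n).
  exact: integrable_mfun (Mi n).
have mMt n : measurable_fun setT (M n \o tau).
  exact: integrable_mfun (integrable_comp (Mi n)).
have mf : measurable_fun setT f by exact: integrable_mfun.
pose A := \bigcap_K \bigcup_n [set s | K%:R < M n s].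
have mA : measurable A.
  apply: bigcap_measurable => // k _; apply: bigcup_measurable => n _.
  exact: measurable_gt.
have AP s : A s <-> forall K : R, exists n, K < M n s.
  split=> H K; last by move=> _; have [n] := H K%:R; exists n.
  have [n _ /= Kn] := H (Num.trunc K).+1 Logic.I.
  by exists n; apply: lt_trans Kn; exact: truncnS_gt.
have At : tau @^-1` A = A.
  apply/seteqP; split=> s /=; rewrite !AP => H K.
    have [n Kn] := H (K - f s); exists n.+1.
    by rewrite /M /= lt_max; apply/orP; right; rewrite -ltrBlDl.
  have [[|n] Kn] := H (Num.max 0 (K + f s)).
    by move: Kn; rewrite /M /= gt_max ltxx.
  exists n; move: Kn; rewrite /M /= gt_max !lt_max ltxx /= => /andP[fM KM].
  by rewrite -(ltrD2l (f s)) addrC; case/orP: KM => // /lt_trans; apply.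
have [A0|A1] := tau_ergodic mA At.
  exists A; split => // s /= unbounded; apply/AP => K; apply: contrapT => h.
  apply: unbounded; exists K => n;
    apply: le_trans (sum_le_max_partial_sum f n s) _.
  by rewrite leNgt; apply/negP => Kn; apply: h; exists n.
pose h n s := Num.max (- M n (tau s)) (f s).
have hE n s : h n s = M n.+1 s - M n (tau s).
  by rewrite /h /M /= addr_maxl sub0r addrK.
have hint n : 0 <= \int[mu]_s h n s.
  rewrite (_ : \int[mu]_s h n s = \int[mu]_s (M n.+1 s - M n (tau s)));
    last first.
    by apply: eq_Rintegral => s _; exact: hE.
  rewrite RintegralB //; last exact: integrable_comp.
  rewrite Rintegral_comp // subr_ge0; apply: le_Rintegral => // s _.
  exact: max_partial_sum_mono.
have [] := @dominated_convergence _ S R mu setT measurableT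
  (fun n s => (h n s)%:E) (EFin \o f) (fun s => `|f s|%:E).
- move=> n; apply/measurable_EFinP; apply: measurable_maxr => //.
  exact: (measurable_funN (mMt n)).
- exact/measurable_EFinP.
- exists (~` A); split; first exact: measurableC.
    by have := probability_setC mu mA; rewrite A1 subee.
  move=> s /= hns As; apply: hns => _; apply: cvg_near_cst.
  have : A (tau s) by move: As; rewrite -[in X in X -> _]At.
  move=> /AP /(_ (- f s))[n0 n0P]; exists n0 => // n /= n0n.
  rewrite /h max_r // lerNl; apply: (le_trans (ltW n0P)).
  have := @max_partial_sum_mono f; rewrite -/M => Mm.
  by rewrite -(subnKC n0n); elim: (n - n0)%N => [|m IH];
    rewrite ?addn0 // addnS;
    apply: le_trans IH (Mm _ _).
- by have := integrable_norm fi.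
- apply: aeW => s n _ /=; rewrite lee_fin /h;
    case: (leP (f s) (- M n (tau s))) => [fM|Mf].
    rewrite normrN ger0_norm ?max_partial_sum_ge0 // ler0_norm;
      first by rewrite lerNr.
    by apply: le_trans fM _; rewrite oppr_le0 max_partial_sum_ge0.
  by [].
move=> _ _ cv.
suff : (0 <= \int[mu]_s (f s)%:E)%E.
  by rewrite EFin_Rintegral // lee_fin leNgt f_neg.
rewrite -(cvg_lim _ cv) //; apply: lime_ge; first by apply/cvg_ex; eexists;
  exact: cv.
apply: nearW => n; have := hint n.
have hi : mu.-integrable setT (EFin \o h n).
  have := integrableB measurableT (Mi n.+1) (integrable_comp (Mi n)).
  by apply: eq_integrable => // s _; rewrite /= hE.
by rewrite /= EFin_Rintegral // lee_fin.
Qed.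

Lemma Rintegral_opp f : mu.-integrable setT (EFin \o f) ->
  \int[mu]_s (- f s) = - \int[mu]_s f s.
Proof.
move=> fi; rewrite -[RHS]mulN1r -RintegralZl //.
by apply: eq_Rintegral => s _; rewrite mulN1r.
Qed.

Lemma integrable_opp f : mu.-integrable setT (EFin \o f) ->
  mu.-integrable setT (EFin \o (fun s => - f s)).
Proof. by move=> /integrableN; apply: eq_integrable. Qed.

Lemma sums_eventually_below f e : mu.-integrable setT (EFin \o f) -> 0 < e ->
  \forall s \ae mu, exists K, forall n,
    \sum_(k < n) f (iter k tau s) <= (\int[mu]_s f s) * n%:R + K + e * n%:R.
Proof.
move=> fi e0; set m := \int[mu]_s f s.
have ci := integrable_const (m + e).
have : mu.-integrable setT (EFin \o (fun s => f s - (m + e))).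
  by have := integrableB measurableT fi ci; apply: eq_integrable.
move=> /sums_bounded_above H; have := H _.
rewrite RintegralB // Rintegral_const -/m.
have le0 : m - (m + e) < 0 by rewrite opprD addrA subrr sub0r oppr_lt0.
move=> /(_ le0); apply: filterS => s [K HK]; exists K => n.
have := HK n; rewrite sumrB sumr_const card_ord -mulr_natr; lra.
Qed.

(** The two bounds follow from [sums_bounded_above], applied to [f - (m + e)]
    and to [- f - (- m + e)], where [m] is the mean of [f]. *)
Theorem birkhoff_mean f : mu.-integrable setT (EFin \o f) ->
  \forall s \ae mu, mean_to (fun k => f (iter k tau s)) (\int[mu]_s f s).
Proof.
move=> fi.
have inv0 (j : nat) : 0 < j.+1%:R^-1 :> R by rewrite invr_gt0.
have := ae_foralln (fun j => sums_eventually_below fi (inv0 j)).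
have := ae_foralln (fun j => sums_eventually_below (integrable_opp fi) (inv0
  j)).
apply: filterS2 => s lo up e e0.
pose j := Num.trunc e^-1.
have je : j.+1%:R^-1 <= e.
  by rewrite -[leRHS]invrK lef_pV2 ?posrE ?invr_gt0 // ltW // truncnS_gt.
have [K1 H1] := up j; have [K2 H2] := lo j.
exists (`|K1| + `|K2|) => n.
have jn : j.+1%:R^-1 * n%:R <= e * n%:R by rewrite ler_wpM2r.
move: (H1 n) (H2 n) jn; rewrite Rintegral_opp // sumrN mulNr.
set m := (X in X * n%:R); set Sn := \sum_(k < n) _; set u := _^-1 * n%:R.
have := ler_norm K1; have := ler_norm K2.
have := normr_ge0 K1; have := normr_ge0 K2.
by move=> *; rewrite ler_norml; apply/andP; split; lra.
Qed.

End measure_preserving_maps.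

(** * Contracting cocycles *)

Section contracting_cocycles.
Context {d : measure_display} {S : measurableType d} {R : realType}.
Variable mu : probability S R.

Lemma tail_small (q : S -> R) (e : R) : measurable_fun setT q -> 0 < e ->
  exists a : R, (mu [set s | (a < q s)%R] < e%:E)%E.
Proof.
move=> mq e0; pose B (k : nat) := [set s | k%:R < q s].
have mB k : measurable (B k) by exact: measurable_gt.
have Bcap : \bigcap_k B k = set0.
  apply/seteqP; split => // s /(_ (Num.trunc (q s)).+1 Logic.I) /=.
  by move=> /(lt_trans (truncnS_gt _)); rewrite ltxx.
have : mu (B k) @[k --> \oo] --> mu (\bigcap_k B k).
  apply: nonincreasing_cvg_mu => //.
  - by apply: (le_lt_trans (probability_le1 mu (mB 0%N))); exact: ltry.
  - rewrite Bcap; exact: measurable0.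
  - move=> i j ij; apply/subsetPset => s /=; apply: le_lt_trans.
    by rewrite ler_nat.
rewrite Bcap measure0 => /fine_cvgP[[n0 _ fin]] /cvgrPdist_lt /(_ e e0)[n1 _ H].
exists (maxn n0 n1)%:R.
have := H (maxn n0 n1) (leq_maxr _ _); rewrite /= sub0r normrN => He.
have := fin (maxn n0 n1) (leq_maxl _ _) => /= /fineK <-.
by rewrite lte_fin; apply: le_lt_trans He; exact: ler_norm.
Qed.

Variable tau : S -> S.
Hypothesis tau_mp : measure_preserving mu tau.
Hypothesis tau_ergodic : ergodic_map mu tau.

Lemma iter_measurable n : measurable_fun setT (iter n tau).
Proof.
elim: n => [|n IH]; first exact: measurable_id.
apply: measurableT_comp IH; exact: tau_mp.1.
Qed.

Lemma indicator_mean (A : set S) (p : pred S) : measurable A ->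
  (forall s, A s <-> p s) ->
  mu.-integrable setT (EFin \o (fun s => (p s)%:R)) /\
  \int[mu]_s (p s)%:R = fine (mu A).
Proof.
move=> mA Ap; have pA : (fun s => (p s)%:R) = \1_A :> (S -> R).
  apply/funext => s; rewrite indicE; congr (_%:R); congr nat_of_bool.
  by apply/idP/idP; rewrite inE => /Ap.
rewrite pA; split; first exact: integrable_indic.
by rewrite /Rintegral integral_indic // setIT.
Qed.

(** The logarithm of [c r] has a negative mean, but [tau] iterated [r] times
    need not be ergodic, so that the blocks of length [r] of a single residue
    class may expand. The other [c i], [i < r], are merely finite: they are
    bounded by a constant except at times of small frequency, and
    [glued_chain_decay] uses them at one of the remaining times to change to
    the best class. The rate is the same at almost every point. *)
Theorem cocycle_decay (c : nat -> S -> R) (r : nat) (b : S -> R) :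
  (0 < r)%N -> (forall n, measurable_fun setT (c n)) ->
  (forall n s, 0 <= c n s) ->
  (forall m n s, c (m + n)%N s <= c m s * c n (iter m tau s)) ->
  (forall s, c r s <= expR (b s)) ->
  mu.-integrable setT (EFin \o b) -> \int[mu]_s b s < 0 ->
  exists2 C : R, 0 < C & \forall s \ae mu,
    exists2 K, 0 <= K & forall n, c n s <= K * expR (- (C * n%:R)).
Proof.
move=> r0 mc c0 cM cb bi bneg; set g := \int[mu]_s b s.
have rR0 : 0 < r%:R :> R by rewrite ltr0n.
exists (- g / (4 * r%:R)); first by rewrite divr_gt0 ?mulr_gt0 ?oppr_gt0.
(* The pieces [c i] in [q s] all end [r] steps after [s]. *)
pose q s := \sum_(i < r) c i (iter (r - i) tau s).
have mq : measurable_fun setT q.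
  apply: measurable_sum => i; apply: measurableT_comp => //.
  exact: iter_measurable.
have r2 : 0 < (2 * r%:R)^-1 :> R by rewrite invr_gt0 mulr_gt0.
have [kappa Hk] := tail_small mq r2.
have [badi badm] := @indicator_mean [set s | kappa < q s]
  (fun s => kappa < q s) (measurable_gt _ mq) (fun s => iff_refl _).
set p := fine _ in badm.
have p0 : 0 <= p by rewrite fine_ge0.
have pr : p * (2 * r%:R) <= 1.
  rewrite -ler_pdivlMr ?mulr_gt0 // div1r -lee_fin /p fineK; first exact: ltW.
  by apply/fin_numPlt; rewrite (lt_trans Hk) ?ltry // (lt_le_trans _
    (measure_ge0 _ _)).
have bpi : mu.-integrable setT (EFin \o (fun s => Num.max (b s) 0)).
  apply: (le_integrable measurableT _ _ bi) => [|s _ /=].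
    apply/measurable_EFinP; apply: measurable_maxr => //.
    exact: integrable_mfun bi.
  by rewrite lee_fin ger0_norm ?le_max ?lexx ?orbT // ge_max normr_ge0 ler_norm.
have := birkhoff_mean tau_mp tau_ergodic bi.
have := birkhoff_mean tau_mp tau_ergodic bpi.
have := birkhoff_mean tau_mp tau_ergodic badi.
apply: filterS3 => s badH bpH bH.
pose cc i j := c (j - i)%N (iter i tau s).
have := @glued_chain_decay _ r cc (fun k => b (iter k tau s))
  (fun k => kappa < q (iter k tau s)) (- g)
  (\int[mu]_s Num.max (b s) 0) p kappa r0.
case=> //.
- by move=> i j; exact: c0.
- move=> i j k /andP[ij jk]; rewrite /cc.
  have -> : (k - i = (j - i) + (k - j))%N by rewrite addnC addnBA // subnK.
  have := cM (j - i)%N (k - j)%N (iter i tau s).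
  by rewrite -iterD subnK.
- by move=> k; rewrite /cc addKn.
- by rewrite oppr_gt0.
- by rewrite opprK.
- by apply: Rintegral_ge0 => s' _; rewrite le_max lexx orbT.
- by rewrite -badm.
- move=> k; rewrite -leNgt => qk i ir; rewrite /cc.
  have -> : (k + r - (k + r - i) = i)%N by rewrite subKn // ltnW // ltn_addl.
  rewrite -addnBA 1?ltnW // addnC iterD.
  apply: le_trans (le_trans qk _); last by apply: le_trans (expR_ge1Dx _);
    rewrite lerDr.
  rewrite /q (bigD1 (Ordinal ir)) //= lerDl; exact: sumr_ge0.
- by move=> K K0 H; exists K => // n; have := H n; rewrite /cc subn0.
Qed.

End contracting_cocycles.

(** * Measurability, compactness and continuity *)

Section measurability_tools.
Context {d : measure_display} {S : measurableType d} {R : realType}.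

Lemma measurable_ex (Q : nat -> set S) : (forall k, measurable (Q k)) ->
  measurable [set s | exists k, Q k s].
Proof.
move=> mQ; rewrite (_ : mkset _ = \bigcup_k Q k);
  first exact: bigcup_measurable.
by apply/seteqP; split=> s [k]; [exists k|move=> _; exists k].
Qed.

Lemma measurable_all (Q : nat -> set S) : (forall k, measurable (Q k)) ->
  measurable [set s | forall k, Q k s].
Proof.
move=> mQ; rewrite (_ : mkset _ = \bigcap_k Q k).
  by apply: bigcap_measurable => // k _; exact: mQ.
by apply/seteqP; split=> s H k; [move=> _; exact: H|exact: H].
Qed.

Lemma measurable_lt_set (f g : S -> R) : measurable_fun setT f ->
  measurable_fun setT g -> measurable [set s | f s < g s].
Proof.
move=> mf mg; rewrite (_ : mkset _ = [set s | 0 < (g \- f) s]).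
  by apply: measurable_gt; exact: measurable_funB.
by apply/seteqP; split=> s /=; rewrite subr_gt0.
Qed.

Lemma measurable_of_gt (f : S -> R) :
  (forall a, measurable [set s | a < f s]) -> measurable_fun setT f.
Proof.
move=> mf; apply: (measurability _ (RGenOInfty.measurableE R)) =>
  _ [_ [a ->] <-].
rewrite setTI (_ : _ @^-1` _ = [set s | a < f s]) //.
by apply/seteqP; split=> s /=; rewrite in_itv /= andbT.
Qed.

(** A function that is Lipschitz in its argument can be evaluated at a random
    point [V s] through a dense sequence [e]:
    [Psi s (V s) = sup_N inf_k (Psi s (e k) + N * dist (e k) (V s))]. *)
Lemma measurable_lipschitz_subst (A : Type) (e : nat -> A) (dist : A -> A -> R)
    (V : S -> A) (Psi : S -> A -> R) :
  (forall x y, 0 <= dist x y) ->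
  (forall x eta, 0 < eta -> exists k, dist (e k) x < eta) ->
  (forall s, exists L, forall x y, `|Psi s x - Psi s y| <= L * dist x y) ->
  (forall k, measurable_fun setT (Psi ^~ (e k))) ->
  (forall k, measurable_fun setT (fun s => dist (e k) (V s))) ->
  measurable_fun setT (fun s => Psi s (V s)).
Proof.
move=> dist0 dense lip mPsi mdist; apply: measurable_of_gt => a.
rewrite (_ : mkset _ = [set s | exists N : nat, exists m : nat, forall k,
    a + m.+1%:R^-1 < Psi s (e k) + N%:R * dist (e k) (V s)]).
  apply: measurable_ex => N; apply: measurable_ex => m;
    apply: measurable_all => k.
  apply: measurable_lt_set; first exact: measurable_cst.
  apply: measurable_funD => //; apply: measurable_funM => //;
    exact: measurable_cst.
apply/seteqP; split=> s /=; have [L HL] := lip s.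
  move=> aPsi; exists (Num.trunc L).+1, (Num.trunc (Psi s (V s) - a)^-1) => k.
  have := HL (e k) (V s); rewrite ler_norml => /andP[H _].
  have N0 : 0 <= dist (e k) (V s) by [].
  have : (Num.trunc (Psi s (V s) - a)^-1).+1%:R^-1 < Psi s (V s) - a.
    rewrite -[ltRHS]invrK ltf_pV2 ?posrE ?invr_gt0 ?subr_gt0 //.
    exact: truncnS_gt.
  have : L * dist (e k) (V s) <= (Num.trunc L).+1%:R * dist (e k) (V s).
    by apply: ler_wpM2r => //; apply: ltW; exact: truncnS_gt.
  move: H; set u := _.+1%:R^-1; set v := _.+1%:R * _; set w := L * _.
  by clearbody u v w; lra.
move=> [N [m H]]; rewrite ltNge; apply/negP => Psia.
pose eta := m.+1%:R^-1 / (`|L| + N%:R + 1) : R.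
have D0 : 0 < `|L| + N%:R + 1 :> R by rewrite ltr_wpDl // addr_ge0.
have eta0 : 0 < eta by rewrite divr_gt0 // invr_gt0.
have [k Hk] := dense (V s) eta eta0.
have := HL (e k) (V s); rewrite ler_norml => /andP[_ H1].
have := H k; apply/negP; rewrite -leNgt.
have H2 : (`|L| + N%:R + 1) * dist (e k) (V s) <= m.+1%:R^-1.
  by rewrite mulrC -ler_pdivlMr // ltW.
have H3 : L * dist (e k) (V s) <= `|L| * dist (e k) (V s).
  by apply: ler_wpM2r => //; exact: ler_norm.
rewrite mulrDl mulrDl mul1r in H2; move: H1 H2 H3 (dist0 (e k) (V s)).
set u := _.+1%:R^-1; set v := N%:R * _; set w := L * _; set z := `|L| * _.
by clearbody u v w z; lra.
Qed.

End measurability_tools.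

Section compact_sets.
Context {T : topologicalType}.

(** Finite subcovers in the form of an induction principle. *)
Lemma compact_induction (K : set T) (Q : set T -> Prop) : compact K ->
  Q set0 -> (forall A B, A `<=` B -> Q B -> Q A) ->
  (forall A B, Q A -> Q B -> Q (A `|` B)) ->
  (forall x, K x -> exists2 U, nbhs x U & Q (K `&` U)) -> Q K.
Proof.
move=> Kc Q0 Qsub QU Qloc; apply: contrapT => nQ.
pose F : set_system T := [set B | Q (K `&` ~` B)].
have FF : ProperFilter F.
  split; first by rewrite /F /= setC0 setIT.
  split.
  - by rewrite /F /= setCT setI0.
  - by move=> A B FA FB; rewrite /F /= setCI setIUr; exact: QU.
  - move=> A B AB; apply: Qsub; apply: setIS; exact: subsetC.
have FK : F K by rewrite /F /= setICr.
have [x [Kx clx]] := Kc F FF FK.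
have [U xU QKU] := Qloc x Kx.
have FU : F (~` U) by rewrite /F /= setCK.
by have [y []] := clx _ _ FU xU.
Qed.

End compact_sets.

Section compact_metric.
Context {R : realType} {T : metricType R}.

Lemma within_continuous_dist (F : pseudoMetricType R) (K : set T) (f : T -> F) :
  {within K, continuous f} -> forall x, K x -> forall e, 0 < e ->
  exists2 r : R, 0 < r & forall y, K y -> mdist x y < r -> ball (f x) e (f y).
Proof.
move=> /subspace_continuousP fc x Kx e e0.
have /cvg_ballP /(_ e e0) := fc x Kx.
rewrite /= near_withinE => /nbhs_ballP[r /= r0 H]; exists r => // y Ky xy.
by apply: H => //; rewrite ballEmdist.
Qed.

Lemma dist_within_continuous (F : pseudoMetricType R) (K : set T) (f : T -> F) :
  (forall x, K x -> forall e, 0 < e ->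
   exists2 r : R, 0 < r & forall y, K y -> mdist x y < r ->
     ball (f x) e (f y)) ->
  {within K, continuous f}.
Proof.
move=> H; apply/subspace_continuousP => x Kx; apply/cvg_ballP => e e0.
have [r r0 Hr] := H x Kx e e0.
rewrite near_withinE; apply/nbhs_ballP; exists r => //= y.
by rewrite ballEmdist /= => xy Ky; exact: Hr.
Qed.

Lemma compact_bounded_above (K : set T) (f : T -> R) : compact K ->
  {within K, continuous f} -> exists B, forall x, K x -> f x <= B.
Proof.
move=> Kc fc; pose Q (A : set T) := exists B, forall x, A x -> f x <= B.
apply: (compact_induction (Q := Q) Kc).
- by exists 0.
- by move=> A B AB [b bP]; exists b => x /AB /bP.
- move=> A B [a aP] [b bP]; exists (Num.max a b) => x [/aP|/bP] H;
    by rewrite le_max H ?orbT.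
- move=> x Kx; have [r r0 Hr] := within_continuous_dist fc Kx ltr01.
  exists (ball x r); first exact: nbhsx_ballx.
  exists (f x + 1) => y [Ky]; rewrite ballEmdist => /(Hr _ Ky) /=.
  by rewrite /ball /= ltr_distlC => /andP[_ /ltW].
Qed.

Lemma compact_dense_sequence (K : set T) : compact K -> K !=set0 ->
  exists2 u : nat -> T, (forall k, K (u k)) &
    forall x e, K x -> 0 < e -> exists k, mdist x (u k) < e.
Proof.
move=> Kc [x0 Kx0].
have net (m : nat) : exists s : seq T,
    (forall y, y \in s -> K y) /\
    forall x, K x -> exists2 y, y \in s & mdist x y < m.+1%:R^-1.
  pose Q (A : set T) := exists s : seq T, (forall y, y \in s -> K y) /\
    forall x, A x -> exists2 y, y \in s & mdist x y < m.+1%:R^-1.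
  apply: (compact_induction (Q := Q) Kc).
  - by exists [::]; split.
  - by move=> A B AB [s [sK sB]]; exists s; split => // x /AB /sB.
  - move=> A B [s [sK sA]] [t [tK tB]]; exists (s ++ t); split => [y|x].
      by rewrite mem_cat => /orP[/sK|/tK].
    by move=> [/sA|/tB] [y ys xy]; exists y; rewrite // mem_cat ys ?orbT.
  - move=> x Kx; exists (ball x m.+1%:R^-1); first by apply: nbhsx_ballx;
      rewrite invr_gt0.
    exists [:: x]; split => [y|y [Ky]]; first by rewrite inE => /eqP ->.
    rewrite ballEmdist /= => xy; exists x; first by rewrite inE.
    by rewrite metric_sym.
have [s sP] := choice net.
pose u k := if unpickle k is Some (m, i) then nth x0 (s m) i else x0.
exists u.
  move=> k; rewrite /u; case: unpickle => [[m i]|] //.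
  case: (ltnP i (size (s m))) => im; last by rewrite nth_default.
  by apply: (sP m).1; exact: mem_nth.
move=> x e Kx e0; pose m := Num.trunc e^-1.
have [y ys xy] := (sP m).2 x Kx.
exists (pickle (m, index y (s m))); rewrite /u pickleK nth_index //.
apply: (lt_le_trans xy); rewrite -[leRHS]invrK lef_pV2 ?posrE ?invr_gt0 //.
by rewrite ltW // truncnS_gt.
Qed.

End compact_metric.

(** * The dynamical system of a stationary sequence *)

(* The carrier of a generated sigma-algebra has to be pointed. *)
HB.instance Definition _ := isPointed.Build int 0.

Section orbit_system.
Context {d : measure_display} {Omega : measurableType d} {R : realType}.
Variable P : probability Omega R.
Context {M : Type}.
Variables (G : set_system M) (Y : int -> Omega -> M).

(** The path space of [Y], pulled back to pairs (time, chance): a function of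
    the pair is measurable when it is one fixed measurable functional of the
    path seen from the current time. Unlike on the path space itself, only the
    paths that [Y] can take occur, so that regularity properties of the values
    of [Y] are available at every point. *)
Definition orbit_gen : set_system (int * Omega) :=
  [set B | exists k C, G C /\ B = [set s | C (Y (s.1 + k) s.2)]].

Definition orbit_space := g_sigma_algebraType orbit_gen.

HB.instance Definition _ := Measurable.copy orbit_space (g_sigma_algebraType
  orbit_gen).

Definition path_from (s : orbit_space) : int -> M := fun k => Y (s.1 + k) s.2.

Definition advance (k : int) (s : orbit_space) : orbit_space := (s.1 + k, s.2).

Lemma advanceD i j s : advance i (advance j s) = advance (j + i) s.
Proof. by rewrite /advance /= addrA. Qed.

Lemma advance0 s : advance 0 s = s.
Proof. by case: s => t w; rewrite /advance /= addr0. Qed.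

Lemma iter_advance n k s : iter n (advance k) s = advance (k *+ n) s.
Proof.
elim: n => [|n IH]; first by rewrite mulr0n advance0.
by rewrite iterS IH advanceD mulrSr.
Qed.

Lemma path_from_advance s : path_from (advance 1 s) = @Defs.shift M (path_from
  s).
Proof.
by apply/funext => k; rewrite /path_from /Defs.shift /= -addrA [1 + k]addrC.
Qed.

Lemma measurable_value k C : G C ->
  measurable ([set s | C (Y (s.1 + k) s.2)] : set orbit_space).
Proof. by move=> GC; apply: sub_sigma_algebra; exists k, C. Qed.

Lemma orbit_measurableP (B : set orbit_space) : measurable B ->
  exists2 A, path_sigma G A & B = path_from @^-1` A.
Proof.
pose H : set_system orbit_space :=
  preimage_set_system setT path_from (path_sigma G).
have sH : sigma_algebra setT H.
  by apply: sigma_algebra_preimage; exact: smallest_sigma_algebra.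
have genH : orbit_gen `<=` H.
  move=> _ [k [C [GC ->]]]; exists [set z | C (z k)].
    by apply: sub_sigma_algebra; exists k, C.
  by rewrite setTI.
move=> /(smallest_sub sH genH) [A sA <-].
by exists A => //; rewrite setTI.
Qed.

Lemma advance_measurable k : measurable_fun setT (advance k).
Proof.
apply: (@measurability _ _ _ orbit_space setT _ orbit_gen) =>
  // _ [_ [j [C [GC ->]]] <-].
rewrite setTI (_ : _ @^-1` _ = [set s | C (Y (s.1 + (k + j)) s.2)]).
  exact: measurable_value.
by apply/seteqP; split=> s; rewrite /= addrA.
Qed.

Definition at_time0 (w : Omega) : orbit_space := (0, w).

Hypothesis Y_stationary : stationary P G Y.
Hypothesis Y_ergodic : ergodic P G Y.

Lemma at_time0_measurable : measurable_fun setT at_time0.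
Proof.
apply: (@measurability _ _ _ orbit_space setT _ orbit_gen) =>
  // _ [_ [j [C [GC ->]]] <-].
rewrite setTI (_ : _ @^-1` _ = Y j @^-1` C); first exact: Y_stationary.1.
by apply/seteqP; split=> w; rewrite /at_time0 /= add0r.
Qed.

Definition orbit_law : probability orbit_space R :=
  distribution P (MeasurableFun.Pack (MeasurableFun.Class
    (isMeasurableFun.Build _ _ _ _ _ at_time0_measurable))).

Lemma orbit_lawE B : orbit_law B = P (at_time0 @^-1` B).
Proof. by []. Qed.

Lemma orbit_law_path A : orbit_law (path_from @^-1` A) = P (path_event Y A).
Proof.
rewrite orbit_lawE; congr (P _); apply/seteqP; split=> w;
  rewrite /path_event /path_from /=;
    suff -> : (fun k => Y (0 + k) w) = Y ^~ w by [];
  by apply/funext => k; rewrite add0r.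
Qed.

Lemma advance1_preserving : measure_preserving orbit_law (advance 1).
Proof.
split; first exact: advance_measurable.
move=> B /orbit_measurableP[A sA ->].
rewrite (_ : advance 1 @^-1` _ = path_from @^-1` (@Defs.shift M @^-1` A)).
  by rewrite !orbit_law_path -Y_stationary.2.
by apply/seteqP; split=> s; rewrite /= path_from_advance.
Qed.

Lemma advanceN1_preserving : measure_preserving orbit_law (advance (-1)).
Proof.
split; first exact: advance_measurable.
move=> B mB; rewrite -(advance1_preserving.2 (advance (-1) @^-1` B)).
  by congr (orbit_law _); apply/seteqP; split=> s;
    rewrite /= advanceD addrN advance0.
by rewrite -[X in measurable X]setTI; exact: advance_measurable.
Qed.

(** An event invariant on the orbit space need not come from a shift-invariant
    event of the path space; the event that it recurs infinitely often does. *)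
Lemma advance1_ergodic : ergodic_map orbit_law (advance 1).
Proof.
move=> B /orbit_measurableP[A sA BA] Binv.
pose io := [set z : int -> M | forall N, exists n,
  (N <= n)%N /\ A (iter n (@Defs.shift M) z)].
have Bn n s : B (iter n (advance 1) s) <-> B s.
  elim: n => [//|n IH]; rewrite -IH iterS.
  by rewrite -[in X in _ <-> X]Binv.
have pathn n s : path_from (iter n (advance 1) s) = iter n (@Defs.shift M)
  (path_from s).
  by elim: n => [//|n IH]; rewrite !iterS path_from_advance IH.
have ioB : path_from @^-1` io = B.
  apply/seteqP; split=> s.
    move=> /(_ 0%N)[n [_]]; rewrite -pathn => An; apply/(Bn n).
    by rewrite BA.
  move=> Bs N; exists N; split=> //; rewrite -pathn.
  by have := (Bn N s).2 Bs; rewrite BA.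
have iter_shift n k z : iter n (@Defs.shift M) z k = z (k + n%:Z).
  elim: n z => [|n IH] z; first by rewrite addr0.
  by rewrite iterSr IH /Defs.shift -addrA -[n.+1]addn1 PoszD.
have sio : path_sigma G io.
  have sG : sigma_algebra setT (path_sigma G) by exact: smallest_sigma_algebra.
  have Gn n : path_sigma G [set z | A (iter n (@Defs.shift M) z)].
    pose H := [set A : set (int -> M) | path_sigma G [set z | A (iter n
      (@Defs.shift M) z)]].
    have sH : sigma_algebra setT H.
      split; rewrite /H /=; first exact: sigma_algebra0.
      - by move=> C HC; exact: (sigma_algebraCD HC).
      - move=> F HF; rewrite (_ : mkset _ = \bigcup_k [set z | F k (iter n
          (@Defs.shift M) z)]).
          exact: sigma_algebra_bigcup.
        by apply/seteqP; split=> z.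
    apply: (smallest_sub sH _ sA) => _ [k [C [GC ->]]].
    apply: sub_sigma_algebra; exists (k + n%:Z), C; split => //.
    by apply/seteqP; split=> z; rewrite /= iter_shift.
  have cap (F : (set (int -> M))^nat) : (forall k, path_sigma G (F k)) ->
      path_sigma G (\bigcap_k F k).
    move=> GF; have GC D : path_sigma G D -> path_sigma G (~` D).
      by move=> GD; rewrite -setTD; exact: sigma_algebraCD.
    rewrite -[\bigcap_k _]setCK setC_bigcap; apply: (GC).
    by apply: sigma_algebra_bigcup => k; exact: GC.
  rewrite (_ : io = \bigcap_N \bigcup_n [set z | (N <= n)%N /\ A (iter n
    (@Defs.shift M) z)]).
    apply: cap => N; apply: sigma_algebra_bigcup => n.
    case: (leqP N n) => Nn.
      suff -> : [set z | true /\ A (iter n (@Defs.shift M) z)] =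
          [set z | A (iter n (@Defs.shift M) z)] by exact: Gn.
      by apply/seteqP; split=> z /= => [[]|].
    suff -> : [set z | false /\ A (iter n (@Defs.shift M) z)] = set0.
      exact: (@sigma_algebra0 _ setT).
    by apply/seteqP; split=> z /= => [[]|].
  apply/seteqP; split=> z Hz N; first by move=> _; have [n Hn] := Hz N;
    exists n.
  by have [n _ Hn] := Hz N Logic.I; exists n.
have ioinv : @Defs.shift M @^-1` io = io.
  apply/seteqP; split=> z /= H N.
    by have [n [Nn]] := H N; rewrite -iterSr => An; exists n.+1; split=> //;
      exact: leqW.
  have [n [Nn An]] := H N.+1; case: n Nn An => // n Nn An; exists n; split=> //.
  by rewrite -iterSr.
by rewrite -ioB orbit_law_path; exact: Y_ergodic.
Qed.

Lemma advanceN1_ergodic : ergodic_map orbit_law (advance (-1)).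
Proof.
move=> B mB Binv; apply: advance1_ergodic => //.
rewrite -[in LHS]Binv; apply/seteqP; split=> s;
  by rewrite /= advanceD addrN advance0.
Qed.

Lemma ae_orbit (Q : orbit_space -> Prop) : (\forall s \ae orbit_law, Q s) ->
  \forall s \ae orbit_law, forall t : int, Q (advance t s).
Proof.
move=> aQ; have := ae_iter advance1_preserving aQ.
have := ae_iter advanceN1_preserving aQ.
apply: filterS2 => s Qn Qp [n|n].
  by have := Qp n; rewrite iter_advance natz.
by have := Qn n.+1; rewrite iter_advance mulNrn natz NegzE.
Qed.

Lemma ae_orbit_law (Q : orbit_space -> Prop) : (\forall s \ae orbit_law, Q s) ->
  \forall w \ae P, forall t : int, Q (t, w).
Proof.
move=> /ae_orbit[N [mN N0 QN]]; exists (at_time0 @^-1` N); split => //.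
  by rewrite -[X in measurable X]setTI; exact: at_time0_measurable.
move=> w /= nQ; apply: QN => /= Q0; apply: nQ => t.
by have := Q0 t; rewrite /advance /= add0r.
Qed.

Lemma integrable_orbit_law (f : orbit_space -> R) : measurable_fun setT f ->
  P.-integrable setT (EFin \o (fun w => f (0, w))) ->
  orbit_law.-integrable setT (EFin \o f) /\
  \int[orbit_law]_s f s = \int[P]_w f (0, w).
Proof.
move=> mf fi; have mEf : measurable_fun setT (EFin \o f) by
  exact/measurable_EFinP.
have fi' : P.-integrable (at_time0 @^-1` setT) ((EFin \o f) \o at_time0).
  by rewrite preimage_setT.
split; first exact: (integrable_pushforward at_time0_measurable mEf fi').
congr fine; have := integral_pushforward at_time0_measurable mEf fi'
  measurableT.
by rewrite preimage_setT.
Qed.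

(** This is how solutions of the recursion, obtained as limits at each point of
    the orbit space, inherit stationarity from [Y]. *)
Lemma factor_stationary (M' : Type) (G' : set_system M') (U : orbit_space ->
  M') :
  (forall B, G' B -> measurable (U @^-1` B)) ->
  stationary P G' (fun t w => U (t, w)).
Proof.
move=> mU; split.
  move=> t B /mU mB; rewrite (_ : _ @^-1` B = at_time0 @^-1` (advance t @^-1`
    (U @^-1` B))).
    rewrite -[X in measurable X]setTI; apply: at_time0_measurable => //.
    by rewrite -[X in measurable X]setTI; exact: advance_measurable.
  by apply/seteqP; split=> w; rewrite /at_time0 /advance /= add0r.
move=> A sA.
pose path' (s : orbit_space) : int -> M' := fun k => U (advance k s).
have mA : measurable (path' @^-1` A).
  pose H := [set A | measurable (path' @^-1` A)].
  have sH : sigma_algebra setT H.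
    split; rewrite /H /=.
    - by rewrite preimage_set0; exact: measurable0.
    - by move=> B mB; rewrite setTD preimage_setC; exact: measurableC.
    - by move=> F mF; rewrite preimage_bigcup; exact: bigcup_measurable.
  apply: (smallest_sub sH _ sA) => _ [k [C [/mU mC ->]]].
  by have := @advance_measurable k measurableT _ mC; rewrite setTI.
have path'E w : path' (at_time0 w) = fun t => U (t, w).
  by apply/funext => k; rewrite /path' /advance /= add0r.
have path'S s : path' (advance 1 s) = @Defs.shift M' (path' s).
  by apply/funext => k; rewrite /path' advanceD /Defs.shift addrC.
have := advance1_preserving.2 _ mA; rewrite !orbit_lawE => E.
transitivity (P (at_time0 @^-1` (path' @^-1` A))).
  by congr (P _); apply/seteqP; split=> w; rewrite /path_event /= path'E.
rewrite -E; congr (P _); apply/seteqP; split=> w;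
  by rewrite /path_event /= path'S path'E.
Qed.

End orbit_system.

(** * The state space *)

Section product_state_space.
Context {R : realType} {F : metricType R} {M : pointedType} {h : M ->
  F} {p : nat}.
Variable dE : state p h -> state p h -> R.
Hypothesis dE_product : product_metric dE.

Lemma img_dist_ge0 (u v : img h) : 0 <= img_dist u v.
Proof. exact: mdist_ge0. Qed.

Lemma img_dist_sym (u v : img h) : img_dist u v = img_dist v u.
Proof. exact: metric_sym. Qed.

Lemma img_dist_triangle (u v w : img h) :
  img_dist u w <= img_dist u v + img_dist v w.
Proof. exact: metric_triangle. Qed.

Lemma img_dist_eq0 (u v : img h) : img_dist u v = 0 -> u = v.
Proof. by move=> /mdist_positivity /val_inj. Qed.

Lemma img_distxx (u : img h) : img_dist u u = 0.
Proof. exact: mdistxx. Qed.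

Lemma img_dist_lip (u v w : img h) :
  `|img_dist u w - img_dist v w| <= img_dist u v.
Proof.
have := img_dist_triangle u v w; have := img_dist_triangle v u w.
rewrite (img_dist_sym v u) ler_norml => H1 H2; apply/andP; split; lra.
Qed.

Lemma dE_ge0 x y : 0 <= dE x y.
Proof.
have [N [Nadd Nscale Npos Nmono ->]] := dE_product.
have N0 : N 0 = 0 by rewrite -(scale0r 0) Nscale normr0 mul0r.
by rewrite -N0; apply: Nmono => j; rewrite !mxE lexx img_dist_ge0.
Qed.

Lemma dE_sym x y : dE x y = dE y x.
Proof.
have [N [_ _ _ _ NE]] := dE_product; rewrite !NE; congr N.
by apply/rowP => j; rewrite !mxE img_dist_sym.
Qed.

Lemma dE_triangle x y z : dE x z <= dE x y + dE y z.
Proof.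
have [N [Nadd Nscale Npos Nmono NE]] := dE_product; rewrite !NE.
apply: le_trans (Nadd _ _); apply: Nmono => j.
by rewrite !mxE img_dist_ge0 img_dist_triangle.
Qed.

Lemma dExx x : dE x x = 0.
Proof.
have [N [Nadd Nscale Npos Nmono ->]] := dE_product.
rewrite (_ : \row_j _ = 0); first by rewrite -(scale0r 0) Nscale normr0 mul0r.
by apply/rowP => j; rewrite !mxE img_distxx.
Qed.

Lemma dE_eq0 x y : dE x y = 0 -> x = y.
Proof.
have [N [Nadd Nscale Npos Nmono ->]] := dE_product => /Npos E.
apply/funext => j; apply: img_dist_eq0.
by have := congr1 (fun v : 'rV_p => v 0 j) E; rewrite !mxE.
Qed.

Lemma dE_gt0 x y : x <> y -> 0 < dE x y.
Proof.
by move=> xy; rewrite lt_neqAle dE_ge0 andbT eq_sym; apply/eqP => /dE_eq0.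
Qed.

Lemma dE_quad x y x' y' : dE x y <= dE x x' + dE x' y' + dE y y'.
Proof.
apply: (le_trans (dE_triangle x x' y)); rewrite -addrA lerD2l (dE_sym y).
exact: dE_triangle.
Qed.

(** Monotonicity on the orthant bounds a norm from below by each of its
    coordinates, so that any product metric is equivalent to a weighted sum
    of the coordinate distances. *)
Lemma product_metric_norm : exists (N : 'rV[R]_p -> R) (c : 'I_p -> R),
  [/\ forall j, 0 < c j,
      forall a b, `|N a - N b| <= \sum_j c j * `|a 0 j - b 0 j|,
      forall x y, dE x y = N (\row_j img_dist (x j) (y j)) &
      forall x y j, c j * img_dist (x j) (y j) <= dE x y].
Proof.
have [N [Nadd Nscale Npos Nmono NE]] := dE_product.
have N0 : N 0 = 0 by rewrite -(scale0r 0) Nscale normr0 mul0r.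
have Nge0 (a : 'rV_p) : 0 <= N a.
  have := Nadd a (- a); rewrite subrr N0 -scaleN1r Nscale normrN1 mul1r.
  by lra.
pose c j := N (delta_mx 0 j).
have Nsum a : N a <= \sum_j c j * `|a 0 j|.
  rewrite {1}(row_sum_delta a).
  apply: (@big_ind2 _ _ (fun v x => N v <= x)); first by rewrite N0.
    by move=> v x w y vx wy; apply: le_trans (Nadd _ _) (lerD vx wy).
  by move=> j _; rewrite Nscale mulrC.
exists N, c; split => //.
- move=> j; rewrite lt_neqAle Nge0 andbT eq_sym; apply/eqP => /Npos E.
  have := congr1 (fun v : 'rV[R]_p => v 0 j) E; rewrite !mxE !eqxx /=.
  by move/eqP; rewrite oner_eq0.
- move=> a b.
  have H u v : N u - N v <= \sum_j c j * `|u 0 j - v 0 j|.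
    rewrite lerBlDr -{1}(subrK v u); apply: (le_trans (Nadd _ _)).
    rewrite lerD2r; apply: (le_trans (Nsum _)).
    by apply: ler_sum => j _; rewrite !mxE.
  rewrite ler_norml H andbT lerNl opprB; apply: (le_trans (H _ _)).
  by apply: ler_sum => j _; rewrite distrC.
- move=> x y j; rewrite NE.
  have -> : c j * img_dist (x j) (y j) = N (img_dist (x j) (y j) *: delta_mx 0
    j).
    by rewrite Nscale ger0_norm ?img_dist_ge0 // mulrC.
  apply: Nmono => i; rewrite !mxE eqxx /=.
  case: eqP => [->|_]; first by rewrite mulr1 img_dist_ge0 lexx.
  by rewrite mulr0 lexx img_dist_ge0.
Qed.

Lemma img_dist_le_dE : exists2 C : R, 0 < C &
  forall x y j, img_dist (x j) (y j) <= C * dE x y.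
Proof.
have [N [c [c0 _ _ cE]]] := product_metric_norm.
exists (1 + \sum_j (c j)^-1).
  by rewrite ltr_pwDl // sumr_ge0 // => j _; rewrite invr_ge0 ltW.
move=> x y j; rewrite -(ler_pM2l (c0 j)); apply: (le_trans (cE x y j)).
rewrite mulrA ler_peMl ?dE_ge0 // -ler_pdivrMl // mulr1.
rewrite (bigD1 j) //= addrCA lerDl addr_ge0 // sumr_ge0 // => i _.
by rewrite invr_ge0 ltW.
Qed.

Lemma dE_le_sum : exists2 c : 'I_p -> R, (forall j, 0 < c j) &
  forall x y, dE x y <= \sum_j c j * img_dist (x j) (y j).
Proof.
have [N [c [c0 Nlip NE _]]] := product_metric_norm.
exists c => // x y.
have N0 : N (\row_j img_dist (x j) (x j)) = 0 by rewrite -NE dExx.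
have := Nlip (\row_j img_dist (x j) (y j)) (\row_j img_dist (x j) (x j)).
rewrite N0 subr0 -NE ger0_norm ?dE_ge0 // => /le_trans; apply.
apply: ler_sum => j _; rewrite !mxE img_distxx subr0 ger0_norm ?img_dist_ge0 //.
Qed.

Lemma dE_small_coord x : forall e, 0 < e -> exists2 r, 0 < r &
  forall y, (forall j, img_dist (x j) (y j) < r) -> dE x y < e.
Proof.
have [c c0 Hc] := dE_le_sum.
move=> e e0; pose C := 1 + \sum_j c j.
have C0 : 0 < C by rewrite ltr_pwDl // sumr_ge0 // => j _; exact: ltW.
exists (e / C); first by rewrite divr_gt0.
move=> y H; apply: (le_lt_trans (Hc x y)).
apply: (@le_lt_trans _ _ (\sum_j c j * (e / C))).
  by apply: ler_sum => j _; apply: ler_wpM2l; apply: ltW.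
by rewrite -mulr_suml mulrCA gtr_pMr // ltr_pdivrMr // mul1r /C ltrDr.
Qed.

Hypothesis dE_separable : dist_separable dE.

Lemma state_dense_sequence : exists e : nat -> state p h,
  forall x eta, 0 < eta -> exists k, dE (e k) x < eta.
Proof.
have [D cD Ddense] := dE_separable.
have x0 : state p h by move=> j; exact: (to_img h point).
have [y0 Dy0 _] := Ddense x0 1 ltr01.
have : (D #<= [set: nat])%card := cD.
move=> /pfcard_geP[D0|[e]]; first by move: Dy0; rewrite D0.
exists e => x eta eta0; have [y Dy xy] := Ddense x eta eta0.
have [k _ ek] := @surj _ _ _ _ e y Dy.
by exists k; rewrite ek dE_sym.
Qed.

Section random_states.
Context {d : measure_display} {S : measurableType d}.

(** Distances to fixed points determine measurability in a separable space, and
    they are real-valued, so that limits and suprema apply to them. *)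
Definition random_state (V : S -> state p h) : Prop :=
  forall j u, measurable_fun setT (fun s => img_dist (V s j) u).

Lemma random_state_cst x : random_state (fun=> x).
Proof. by move=> j u; exact: measurable_cst. Qed.

Lemma measurable_dE_of_coords (U V : S -> state p h) :
  (forall j, measurable_fun setT (fun s => img_dist (U s j) (V s j))) ->
  measurable_fun setT (fun s => dE (U s) (V s)).
Proof.
have [N [c [c0 Nlip NE _]]] := product_metric_norm.
move=> mUV; pose row s : 'rV[R]_p := \row_j img_dist (U s j) (V s j).
rewrite (_ : (fun s => _) = (fun s => N (row s))); last first.
  by apply/funext => s; rewrite NE.
pose e (k : nat) : 'rV[R]_p := if unpickle k is Some v then map_mx ratr (v :
  'rV[rat]_p) else 0.
apply: (@measurable_lipschitz_subst _ S R _ e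
  (fun a b => \sum_j c j * `|a 0 j - b 0 j|) row (fun _ a => N a)).
- by move=> a b; apply: sumr_ge0 => j _; rewrite mulr_ge0 // ltW.
- move=> a eta eta0; pose C := 1 + \sum_j c j.
  have C0 : 0 < C by rewrite ltr_pwDl // sumr_ge0 // => j _; exact: ltW.
  have eC : 0 < eta / C by rewrite divr_gt0.
  have approx j : exists q : rat, `|ratr q - a 0 j| < eta / C.
    have lt_itv : a 0 j - eta / C < a 0 j + eta / C by lra.
    have [q] := rat_in_itvoo lt_itv; rewrite in_itv /= => /andP[q1 q2].
    by exists q; rewrite ltr_distl q1 q2.
  have [q qP] := choice approx.
  exists (pickle (\row_j q j)); rewrite /e pickleK.
  apply: (@le_lt_trans _ _ (\sum_j c j * (eta / C))).
    by apply: ler_sum => j _; rewrite !mxE; apply: ler_wpM2l; apply: ltW.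
  by rewrite -mulr_suml mulrCA gtr_pMr // ltr_pdivrMr // mul1r /C ltrDr.
- by move=> s; exists 1 => a b; rewrite mul1r; exact: Nlip.
- by move=> k; exact: measurable_cst.
- move=> k; apply: measurable_sum => j.
  apply: measurable_funM; first exact: measurable_cst.
  apply: measurableT_comp; first exact: normr_measurable.
  apply: measurable_funB; first exact: measurable_cst.
  by rewrite (_ : (fun s => _) = (fun s => img_dist (U s j) (V s j))) //;
    apply/funext => s; rewrite mxE.
Qed.

Lemma random_state_dE_cst V x : random_state V ->
  measurable_fun setT (fun s => dE x (V s)).
Proof.
move=> rV; apply: measurable_dE_of_coords => j.
rewrite (_ : (fun s => _) = (fun s => img_dist (V s j) (x j))) //.
by apply/funext => s; rewrite img_dist_sym.
Qed.

Lemma random_state_dE U V : random_state U -> random_state V ->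
  measurable_fun setT (fun s => dE (U s) (V s)).
Proof.
move=> rU rV; have [e eP] := state_dense_sequence.
have [C C0 CP] := img_dist_le_dE.
apply: measurable_dE_of_coords => j.
apply: (@measurable_lipschitz_subst _ S R _ e dE V
  (fun s y => img_dist (U s j) (y j))).
- exact: dE_ge0.
- exact: eP.
- move=> s; exists C => x y; rewrite !(img_dist_sym (U s j)).
  by apply: (le_trans (img_dist_lip _ _ _)); exact: CP.
- by move=> k; exact: rU.
- by move=> k; exact: random_state_dE_cst.
Qed.

Lemma random_state_subst (f : S -> state p h -> state p h) V :
  (forall s, exists L, forall x y, dE (f s x) (f s y) <= L * dE x y) ->
  (forall x, random_state (f ^~ x)) -> random_state V ->
  random_state (fun s => f s (V s)).
Proof.
move=> lip rf rV j u; have [e eP] := state_dense_sequence.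
have [C C0 CP] := img_dist_le_dE.
apply: (@measurable_lipschitz_subst _ S R _ e dE V
  (fun s y => img_dist (f s y j) u)).
- exact: dE_ge0.
- exact: eP.
- move=> s; have [L HL] := lip s; exists (C * L) => x y.
  apply: (le_trans (img_dist_lip _ _ _)); apply: (le_trans (CP _ _ _)).
  by rewrite -mulrA ler_wpM2l // ltW.
- by move=> k; exact: rf.
- by move=> k; exact: random_state_dE_cst.
Qed.

Lemma random_state_comp V (tau : S -> S) : random_state V ->
  measurable_fun setT tau -> random_state (V \o tau).
Proof.
by move=> rV mtau j u; apply: (measurableT_comp (rV j u) mtau).
Qed.

Lemma random_state_limit (V : nat -> S -> state p h) W :
  (forall n, random_state (V n)) ->
  (forall s e, 0 < e -> exists n0, forall n, (n0 <= n)%N ->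
    dE (V n s) (W s) < e) ->
  random_state W.
Proof.
move=> rV VW j u; have [C C0 CP] := img_dist_le_dE.
apply: (@measurable_fun_cvg _ _ _ setT (fun n s => img_dist (V n s j) u)).
  by move=> n; exact: rV.
move=> s _; apply/cvgrPdist_lt => e e0.
have [n0 Hn0] := VW s (e / C) (divr_gt0 e0 C0).
exists n0 => // n /= /Hn0 H.
apply: (le_lt_trans (img_dist_lip _ _ _)); apply: (le_lt_trans (CP _ _ _)).
by rewrite dE_sym mulrC -ltr_pdivlMr.
Qed.

Lemma random_state_if (A : set S) V W : measurable A ->
  random_state V -> random_state W ->
  random_state (fun s => if s \in A then V s else W s).
Proof.
move=> mA rV rW j u; apply: measurable_of_gt => a.
rewrite (_ : mkset _ = (A `&` [set s | a < img_dist (V s j) u]) `|`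
    (~` A `&` [set s | a < img_dist (W s j) u])).
  apply: measurableU; apply: measurableI; rewrite ?measurableC //;
    by [exact: measurable_gt|exact: measurableC].
apply/seteqP; split=> s /=; case: ifPn => [/set_mem|/negP] sA.
- by left.
- by right; split=> // As; apply: sA; rewrite inE.
- by case=> [[]|[]].
- by case=> [[/mem_set]|[]].
Qed.

Lemma random_state_open V j B : random_state V -> img_open B ->
  measurable [set s | B (V s j)].
Proof.
move=> rV [U oU BU]; have [e eP] := state_dense_sequence.
have [C C0 CP] := img_dist_le_dE.
rewrite (_ : mkset _ = [set s | exists k m : nat,
    (forall u, img_dist u (e k j) < m.+1%:R^-1 -> B u) /\
    img_dist (V s j) (e k j) < m.+1%:R^-1]).
  apply: measurable_ex => k; apply: measurable_ex => m.
  have [H|H] := pselect (forall u, img_dist u (e k j) < m.+1%:R^-1 -> B u).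
    rewrite [X in measurable X](_ : _ = [set s | img_dist (V s j) (e k j) <
      m.+1%:R^-1]).
      by apply: measurable_lt_set; [exact: rV|exact: measurable_cst].
    by apply/seteqP; split=> s /= => [[]|].
  rewrite [X in measurable X](_ : _ = set0) //; by apply/seteqP;
    split=> s /= => [[]|].
apply/seteqP; split=> s /=; last by move=> [k [m [H /H]]].
rewrite {1}BU /= => UV.
have /nbhs_ballP[r /= r0 rU] : nbhs (\val (V s j)) U by exact: open_nbhs_nbhs.
pose m := Num.trunc (r / 2)^-1.
have r20 : 0 < r / 2 by rewrite divr_gt0.
have mr : m.+1%:R^-1 < r / 2.
  by rewrite -[ltRHS]invrK ltf_pV2 ?posrE ?invr_gt0 // truncnS_gt.
have m0 : 0 < m.+1%:R^-1 :> R by rewrite invr_gt0.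
have [k Hk] := eP (V s) _ (divr_gt0 m0 C0).
have ek : img_dist (V s j) (e k j) < m.+1%:R^-1.
  rewrite img_dist_sym; apply: (le_lt_trans (CP _ _ _)).
  by rewrite mulrC -ltr_pdivlMr.
exists k, m; split=> // u uk; rewrite BU /=; apply: rU; rewrite ballEmdist /=.
apply: (le_lt_trans (img_dist_triangle (V s j) (e k j) u)).
by rewrite (img_dist_sym _ u); move: ek uk mr; set z := _^-1; clearbody z; lra.
Qed.

End random_states.
End product_state_space.

(** * Iterated random maps and their Lipschitz coefficients *)

Section iterated_maps.
Context {d : measure_display} {Omega : measurableType d} {R : realType}.
Context {n : nat} {F T : metricType R} {h : 'M[R]_n -> F} {p : nat}.
Variables (Theta : set T) (dE : state p h -> state p h -> R).
Variable phi : int -> Omega -> state p h -> T -> state p h.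
Variable Lam : nat -> int -> Omega -> T -> R.

Local Notation S := (orbit_space (map_cylinders Theta (p := p)) phi).

Lemma iter_mapsD (E : Type) (f : int -> E -> E) i j t x :
  iter_maps f (i + j) t x = iter_maps f i t (iter_maps f j (t - i%:Z) x).
Proof.
elim: i t => [|i IH] t /=; first by rewrite subr0.
by rewrite IH -addn1 PoszD opprD addrA [in RHS]addrAC.
Qed.

Definition orbit_iter (r : nat) (theta : T) (s : S) : state p h -> state p h :=
  iter_maps (fun t x => phi t s.2 x theta) r s.1.

Lemma orbit_iterD i j theta s x : orbit_iter (i + j) theta s x =
  orbit_iter i theta s (orbit_iter j theta (advance (- i%:Z) s) x).
Proof. exact: iter_mapsD. Qed.

Lemma orbit_iterS r theta s x : orbit_iter r.+1 theta s x =
  phi s.1 s.2 (orbit_iter r theta (advance (-1) s) x) theta.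
Proof. by []. Qed.

Hypothesis dE_product : product_metric dE.
Hypothesis dE_separable : dist_separable dE.
Hypothesis Theta_compact : compact Theta.
Hypothesis phi_continuous : forall t w x j,
  {within Theta, continuous (fun theta => \val (phi t w x theta j) : F)}.
Hypothesis Lam_continuous : forall r t w, (0 < r)%N ->
  {within Theta, continuous (Lam r t w)}.
Hypothesis Lam_bound : forall r t w theta, (0 < r)%N -> Theta theta ->
  (lip_coef dE (iter_maps (fun s x => phi s w x theta) r t) <=
   (Lam r t w theta)%:E)%E.

Lemma orbit_iter_lip r theta s x y : (0 < r)%N -> Theta theta ->
  dE (orbit_iter r theta s x) (orbit_iter r theta s y) <=
  Lam r s.1 s.2 theta * dE x y.
Proof.
move=> r0 Ht; have [->|xy] := pselect (x = y); first by rewrite !dExx // mulr0.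
rewrite -ler_pdivrMr ?dE_gt0 // -lee_fin.
apply: le_trans (Lam_bound s.1 s.2 r0 Ht); apply: ereal_sup_ubound.
by exists (x, y).
Qed.

Lemma orbit_iter_lip_unif r s : exists2 L, 0 <= L &
  forall theta x y, Theta theta ->
  dE (orbit_iter r theta s x) (orbit_iter r theta s y) <= L * dE x y.
Proof.
case: r => [|r]; first by exists 1 => // theta x y _; rewrite mul1r.
have [B HB] := compact_bounded_above Theta_compact (@Lam_continuous r.+1 s.1
  s.2 (ltn0Sn r)).
exists `|B| => // theta x y Ht;
  apply: (le_trans (orbit_iter_lip _ _ _ _ Ht)) => //.
apply: ler_wpM2r; first exact: dE_ge0.
exact: le_trans (HB _ Ht) (ler_norm B).
Qed.

Lemma common_radius (Q : 'I_p -> R -> Prop) :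
  (forall j r r', r' <= r -> Q j r -> Q j r') ->
  (forall j, exists2 r, 0 < r & Q j r) -> exists2 r, 0 < r & forall j, Q j r.
Proof.
move=> Qdown HQ.
have /choice[rad radP] : forall j, exists r, 0 < r /\ Q j r.
  by move=> j; have [r] := HQ j; exists r.
exists (1 + \sum_j (rad j)^-1)^-1.
  rewrite invr_gt0 ltr_pwDl // sumr_ge0 // => j _; rewrite invr_ge0.
  exact: ltW (radP j).1.
move=> j; apply: (Qdown _ _ _ _ (radP j).2).
have rj := (radP j).1.
have S0 : 0 <= \sum_(i | i != j) (rad i)^-1.
  by apply: sumr_ge0 => i _; rewrite invr_ge0; exact: ltW (radP i).1.
have rj' : 0 < (rad j)^-1 by rewrite invr_gt0.
by rewrite -[leRHS]invrK lef_pV2 ?posrE ?invr_gt0 //; rewrite (bigD1 j) //=;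
  lra.
Qed.

Lemma phi_continuous_dE t w x theta e : Theta theta -> 0 < e ->
  exists2 r, 0 < r & forall theta', Theta theta' -> mdist theta theta' < r ->
    dE (phi t w x theta) (phi t w x theta') < e.
Proof.
move=> Ht e0; have [c c0 Hc] := dE_small_coord dE_product (phi t w x theta) e0.
suff [r r0 Hr] : exists2 r, 0 < r & forall j theta', Theta theta' ->
    mdist theta theta' < r ->
    img_dist (phi t w x theta j) (phi t w x theta' j) < c.
  by exists r => // theta' Ht' rt; apply: Hc => j; exact: Hr.
apply: common_radius.
- by move=> j r r' rr' H theta' Ht' rt; apply: H => //; exact: lt_le_trans rr'.
- move=> j; have := within_continuous_dist (@phi_continuous t w x j) Ht c0.
  by move=> [r r0 H]; exists r => // theta' Ht' /(H _ Ht'); rewrite ballEmdist.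
Qed.

(** Continuity in the parameter survives composition because the outer maps
    are Lipschitz in the state, uniformly in the parameter. *)
Lemma orbit_iter_continuous r s x theta e : Theta theta -> 0 < e ->
  exists2 c, 0 < c & forall theta', Theta theta' -> mdist theta theta' < c ->
    dE (orbit_iter r theta s x) (orbit_iter r theta' s x) < e.
Proof.
move=> Ht; elim: r s e => [|r IH] s e e0.
  by exists 1 => // theta' _ _; rewrite dExx.
have e20 : 0 < e / 2 by rewrite divr_gt0.
pose u := orbit_iter r theta (advance (-1) s) x.
have [c1 c10 H1] := phi_continuous_dE s.1 s.2 u Ht e20.
have [L L0 HL] := orbit_iter_lip_unif 1 s.
have L1 : 0 < L + 1 by rewrite ltr_wpDl.
have [c2 c20 H2] := IH (advance (-1) s) _ (divr_gt0 e20 L1).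
exists (Num.min c1 c2); first by rewrite lt_min c10.
move=> theta' Ht'; rewrite lt_min => /andP[t1 t2]; rewrite !orbit_iterS.
apply: (le_lt_trans (dE_triangle dE_product _ (phi s.1 s.2 u theta') _)).
have := H1 _ Ht' t1; have := HL theta' u (orbit_iter r theta' (advance (-1) s)
  x) Ht'.
rewrite /orbit_iter /= -!/(orbit_iter _ _ _ _) => a1 a2.
have := H2 _ Ht' t2; rewrite -/u ltr_pdivlMr // => a3.
have := dE_ge0 dE_product u (orbit_iter r theta' (advance (-1) s) x).
move: a1 a2 a3; rewrite /u /orbit_iter /=.
set A := dE _ _; set B := dE _ _; set D := dE _ _; clearbody A B D; lra.
Qed.

Lemma phi_random_state x theta : Theta theta ->
  random_state (fun s : S => phi s.1 s.2 x theta).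
Proof.
move=> Ht j u; apply: measurable_of_gt => a.
have oB : @img_open _ _ _ h [set v | a < img_dist v u].
  exists [set v : F | a < mdist v (\val u)] => //.
  rewrite openE => v /= av; apply/nbhs_ballP.
  exists (mdist v (\val u) - a); first by rewrite /= subr_gt0.
  move=> z; rewrite ballEmdist /= => vz.
  have := metric_triangle v z (\val u); lra.
have := @measurable_value _ Omega _ (map_cylinders Theta (p := p)) phi 0
  [set f | a < img_dist (f x theta j) u].
rewrite (_ : mkset _ = [set s : S | a < img_dist (phi s.1 s.2 x theta j) u]).
  by apply; exists x, theta, j, [set v | a < img_dist v u].
by apply/seteqP; split=> s; rewrite /= addr0.
Qed.

Lemma orbit_iter_random_state r theta x : Theta theta ->
  random_state (orbit_iter r theta ^~ x).
Proof.
move=> Ht; elim: r => [|r IH]; first exact: random_state_cst.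
apply: (random_state_subst dE_product dE_separable
  (f := fun s : S => (phi s.1 s.2)^~ theta)
  (V := fun s : S => orbit_iter r theta (advance (-1) s) x)).
- move=> s; have [L _ HL] := orbit_iter_lip_unif 1 s.
  by exists L => y z; exact: (HL theta y z Ht).
- by move=> y; exact: phi_random_state.
- exact: (random_state_comp IH (@advance_measurable _ Omega _ _ phi (-1))).
Qed.

Section lipschitz_supremum.
Variable K : set T.
Hypotheses (KTheta : K `<=` Theta) (K_compact : compact K) (K_nonempty :
  K !=set0).

(** The value [0] keeps the supremum nonnegative. *)
Definition lip_ratios (r : nat) (s : S) : set R :=
  [set l | l = 0 \/ exists theta x y, [/\ K theta, x <> y &
    l = dE (orbit_iter r theta s x) (orbit_iter r theta s y) / dE x y]].

Definition sup_lip (r : nat) (s : S) : R := sup (lip_ratios r s).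

Lemma lip_ratios_le r s B : 0 <= B -> (forall theta x y, K theta ->
    dE (orbit_iter r theta s x) (orbit_iter r theta s y) <= B * dE x y) ->
  ubound (lip_ratios r s) B.
Proof.
move=> B0 HB l [->//|[theta [x [y [Kt xy ->]]]]].
by rewrite ler_pdivrMr ?dE_gt0 //; exact: HB.
Qed.

Lemma lip_ratios_has_sup r s : has_sup (lip_ratios r s).
Proof.
split; first by exists 0; left.
have [L L0 HL] := orbit_iter_lip_unif r s; exists L.
by apply: lip_ratios_le => // theta x y /KTheta; exact: HL.
Qed.

Lemma sup_lip_ge0 r s : 0 <= sup_lip r s.
Proof. by apply: ub_le_sup; [exact: (lip_ratios_has_sup r s).2|left]. Qed.

Lemma sup_lipP r theta s x y : K theta ->
  dE (orbit_iter r theta s x) (orbit_iter r theta s y) <= sup_lip r s * dE x y.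
Proof.
move=> Kt; have [->|xy] := pselect (x = y); first by rewrite !dExx // mulr0.
rewrite -ler_pdivrMr ?dE_gt0 //; apply: ub_le_sup.
  exact: (lip_ratios_has_sup r s).2.
by right; exists theta, x, y.
Qed.

Lemma sup_lip_le r s B : 0 <= B -> (forall theta x y, K theta ->
    dE (orbit_iter r theta s x) (orbit_iter r theta s y) <= B * dE x y) ->
  sup_lip r s <= B.
Proof.
move=> B0 HB; apply: sup_le_ub; first exact: (lip_ratios_has_sup r s).1.
exact: lip_ratios_le.
Qed.

Lemma sup_lipD i j s :
  sup_lip (i + j) s <= sup_lip i s * sup_lip j (advance (- i%:Z) s).
Proof.
apply: sup_lip_le; first by rewrite mulr_ge0 // sup_lip_ge0.
move=> theta x y Kt; rewrite !orbit_iterD;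
  apply: (le_trans (sup_lipP _ _ _ _ Kt)).
by rewrite -mulrA ler_wpM2l ?sup_lip_ge0 // sup_lipP.
Qed.

Lemma sup_lip_le_Lam r s B : (0 < r)%N -> 0 <= B ->
  (forall theta, K theta -> Lam r s.1 s.2 theta <= B) -> sup_lip r s <= B.
Proof.
move=> r0 B0 HB; apply: sup_lip_le => // theta x y Kt.
apply: (le_trans (orbit_iter_lip _ _ _ r0 (KTheta Kt))).
by apply: ler_wpM2r; [exact: dE_ge0|exact: HB].
Qed.

(** By continuity in the parameter and in the state, the supremum can be taken
    over countable dense sets; this is where the true Lipschitz coefficients
    of the iterates become functionals of the path of [phi]. *)
Lemma sup_lip_measurable r : measurable_fun setT (sup_lip r).
Proof.
have [v Kv vdense] := compact_dense_sequence K_compact K_nonempty.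
have [e edense] := state_dense_sequence dE_product dE_separable.
apply: measurable_of_gt => a; have [a0|a0] := ltP a 0.
  rewrite [X in measurable X](_ : _ = setT) //.
  by apply/seteqP; split=> s //= _; apply: (lt_le_trans a0); exact: sup_lip_ge0.
rewrite [X in measurable X](_ : _ = [set s : S | exists k i l : nat,
    a * dE (e i) (e l) < dE (orbit_iter r (v k) s (e i)) (orbit_iter r (v k) s
      (e l))]).
  do 3 apply: measurable_ex => ?; apply: measurable_lt_set.
    exact: measurable_cst.
  by apply: random_state_dE => //; apply: orbit_iter_random_state;
    exact: KTheta.
apply/seteqP; split=> s /=; last first.
  move=> [k [i [l H]]]; have := sup_lipP r s (e i) (e l) (Kv k).
  move=> /(lt_le_trans H); have [E0|E0] := eqVneq (dE (e i) (e l)) 0.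
    by rewrite E0 !mulr0 ltxx.
  by rewrite ltr_pM2r // lt_neqAle eq_sym E0 dE_ge0.
move=> /(sup_gt (lip_ratios_has_sup r s).1)[l [->|]]; first by rewrite ltNge a0.
move=> [theta [x [y [Kt xy ->]]]]; rewrite ltr_pdivlMr ?dE_gt0 // => gap.
(* The strict inequality at [(theta, x, y)] leaves a gap [g]; moving the
   parameter costs [g / 4], and moving the two states another [g / 4]. *)
pose g := dE (orbit_iter r theta s x) (orbit_iter r theta s y) - a * dE x y.
have g0 : 0 < g by rewrite subr_gt0.
have g8 : 0 < g / 8 by rewrite divr_gt0.
have [c1 c10 H1] := orbit_iter_continuous r s x (KTheta Kt) g8.
have [c2 c20 H2] := orbit_iter_continuous r s y (KTheta Kt) g8.
have c0 : 0 < Num.min c1 c2 by rewrite lt_min c10.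
have [k] := vdense theta _ Kt c0; rewrite lt_min => /andP[k1 k2].
have {H1}H1 := H1 _ (KTheta (Kv k)) k1; have {H2}H2 := H2 _ (KTheta (Kv k)) k2.
have [L L0 HL] := orbit_iter_lip_unif r s.
have La : 0 < L + a + 1 by rewrite ltr_wpDl // addr_ge0.
pose c := g / 8 / (L + a + 1); have cc0 : 0 < c by rewrite divr_gt0.
have [i Hi] := edense x _ cc0; have [m Hm] := edense y _ cc0.
exists k, i, m.
have Tv := KTheta (Kv k).
have q1 := dE_quad dE_product (orbit_iter r theta s x) (orbit_iter r theta s y)
  (orbit_iter r (v k) s x) (orbit_iter r (v k) s y).
have q2 := dE_quad dE_product (orbit_iter r (v k) s x) (orbit_iter r (v k) s y)
  (orbit_iter r (v k) s (e i)) (orbit_iter r (v k) s (e m)).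
have q3 := dE_quad dE_product (e i) (e m) x y.
have lx := HL _ x (e i) Tv; have ly := HL _ y (e m) Tv.
rewrite (dE_sym dE_product x) in lx; rewrite (dE_sym dE_product y) in ly.
have ai := ler_wpM2l a0 q3; rewrite !mulrDr in ai.
have cE : (L + a + 1) * c = g / 8 by rewrite mulrC /c divfK // gt_eqF.
have mi : L * dE (e i) x + a * dE (e i) x <= g / 8.
  rewrite -mulrDl -cE; apply: ler_pM.
  - exact: addr_ge0.
  - exact: dE_ge0.
  - by rewrite lerDl.
  - exact: ltW.
have ml : L * dE (e m) y + a * dE (e m) y <= g / 8.
  rewrite -mulrDl -cE; apply: ler_pM.
  - exact: addr_ge0.
  - exact: dE_ge0.
  - by rewrite lerDl.
  - exact: ltW.
have gE : dE (orbit_iter r theta s x) (orbit_iter r theta s y) = g + a * dE x y.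
  by rewrite /g subrK.
rewrite gE in q1; clear gE cE; clearbody g.
move: H1 H2 q1 q2 lx ly ai mi ml g0.
move: (a * dE x y) (a * dE (e i) x) (a * dE (e m) y) (a * dE (e i) (e m))
  (L * dE (e i) x) (L * dE (e m) y) => A1 A2 A3 A4 A5 A6.
move: (dE (orbit_iter r (v k) s (e i)) _) (dE (orbit_iter r (v k) s x)
  (orbit_iter r (v k) s y))
 (dE (orbit_iter r (v k) s x) _) (dE (orbit_iter r (v k) s y) _)
 (dE (orbit_iter r theta s x) _) (dE (orbit_iter r theta s y) _) =>
   B1 B2 B3 B4 B5 B6.
lra.
Qed.

End lipschitz_supremum.

End iterated_maps.

(** * Logarithmic moments *)

Section integral_comparisons.
Context {d : measure_display} {Omega : measurableType d} {R : realType}.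
Variable P : probability Omega R.

(** The integral of a nonnegative function is a supremum over the simple
    functions below it, hence monotone among arbitrary functions, such as the
    suprema over parameters in the moment conditions. *)
Lemma le_integral_ge0 (f g : Omega -> \bar R) :
  (forall w, 0 <= f w)%E -> (forall w, f w <= g w)%E ->
  (\int[P]_w f w <= \int[P]_w g w)%E.
Proof.
move=> f0 fg; have g0 w : (0 <= g w)%E by exact: le_trans (fg w).
rewrite !ge0_integralTE //; apply: le_ereal_sup => _ [k /= kf <-].
by exists k => //= w; exact: le_trans (fg w).
Qed.

Lemma integrable_le_bound (f : Omega -> R) (g : Omega -> \bar R) (c : R) :
  measurable_fun setT f -> (forall w, 0 <= g w)%E -> 0 <= c ->
  (forall w, `|f w|%:E <= g w + c%:E)%E -> (\int[P]_w g w < +oo)%E ->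
  P.-integrable setT (EFin \o f).
Proof.
move=> mf g0 c0 fg gfin; pose f1 w := Num.max (`|f w| - c) 0.
have mf1 : measurable_fun setT f1.
  apply: measurable_maxr; last exact: measurable_cst.
  apply: measurable_funB; last exact: measurable_cst.
  by apply: measurableT_comp mf; exact: normr_measurable.
have f10 w : 0 <= f1 w by rewrite le_max lexx orbT.
have f1i : P.-integrable setT (EFin \o f1).
  apply/integrableP; split; first exact/measurable_EFinP.
  apply: le_lt_trans gfin; apply: le_integral_ge0 => w; first exact: abse_ge0.
  rewrite /= ger0_norm // /f1; case: (leP (`|f w| - c) 0) => H; first exact: g0.
  by have := fg w; rewrite EFinB leeBlDr.
have ci := integrable_const P c.
have := integrableD measurableT f1i ci.
apply: le_integrable => // [|w _]; first exact/measurable_EFinP.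
rewrite /= lee_fin (ger0_norm (addr_ge0 (f10 w) c0)).
by rewrite -lerBlDr le_max lexx.
Qed.

(** Monotone convergence applies to the differences [phi 0 - phi k], which
    increase to [phi 0 - log L]; this covers the case [E log L = - oo], where
    the integrals of the [phi k] have no finite limit. *)
Lemma integral_neg_approx (L : Omega -> R) (phi : nat -> Omega -> R) :
  measurable_fun setT L -> (forall w, 0 <= L w) ->
  (forall k, measurable_fun setT (phi k)) ->
  (forall k w, phi k.+1 w <= phi k w) ->
  (forall w, ln (Num.max (L w) 1) <= phi 0%N w) ->
  (forall k w, - k%:R <= phi k w) ->
  (forall w eta, L w < eta -> exists k, phi k w <= ln eta) ->
  P.-integrable setT (EFin \o phi 0%N) ->
  (\int[P]_w lne (L w)%:E < 0)%E ->
  exists k, P.-integrable setT (EFin \o phi k) /\ \int[P]_w phi k w < 0.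
Proof.
move=> mL L0 mphi phidec lamphi phiN phiL phi0i Lneg.
have phimono w : {homo (phi ^~ w) : i j / (i <= j)%N >-> j <= i}.
  move=> i j ij; rewrite -(subnKC ij); elim: (j - i)%N => [|m IH];
    first by rewrite addn0.
  by rewrite addnS; exact: le_trans (phidec _ _) IH.
have phii k : P.-integrable setT (EFin \o phi k).
  have := integrableD measurableT phi0i (integrable_const P k%:R).
  apply: le_integrable => // [|w _]; first exact/measurable_EFinP.
  have phi00 : 0 <= phi 0%N w.
    by apply: le_trans (lamphi w); apply: ln_ge0; rewrite le_max lexx orbT.
  rewrite /= lee_fin (ger0_norm (addr_ge0 phi00 (ler0n R k))) ler_norml.
  have := phiN k w; have := phimono w _ _ (leq0n k); have := ler0n R k.
  by move=> *; apply/andP; split; lra.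
pose ell w := lne (L w)%:E; pose lam w := ln (Num.max (L w) 1).
have lam0 w : 0 <= lam w by apply: ln_ge0; rewrite le_max lexx orbT.
have mlam : measurable_fun setT lam.
  by apply: (measurableT_comp (@measurable_ln R)); apply: measurable_maxr.
have mell : measurable_fun setT ell.
  rewrite (_ : ell = fun w => if L w <= 0 then -oo%E else (ln (L w))%:E).
    apply: measurable_fun_ifT.
    - apply: measurable_fun_ler => //; exact: measurable_cst.
    - exact: measurable_cst.
    - by apply/measurable_EFinP; exact: (measurableT_comp (@measurable_ln R)).
  apply/funext => w; rewrite /ell; case: ifPn => Lw.
    by rewrite le0_lneNy // lee_fin.
  by rewrite lne_EFin // ltNge.
have ellp w : (ell^\+ w = (lam w)%:E)%E.
  rewrite funeposE /ell /lam; case: (leP (L w) 0) => Lw.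
    rewrite le0_lneNy ?lee_fin // maxNye (max_r (le_trans Lw _)) // ?ln1 //.
  rewrite lne_EFin //; case: (leP (L w) 1) => L1.
    by rewrite ln1; apply/max_idPr; rewrite lee_fin ln_le0.
  by apply/max_idPl; rewrite lee_fin ln_ge0 // ltW.
pose A := (\int[P]_w (phi 0%N w - lam w)%:E)%E.
have lami : P.-integrable setT (EFin \o lam).
  apply: (le_integrable measurableT _ _ phi0i); first exact/measurable_EFinP.
  move=> w _; rewrite /= lee_fin (ger0_norm (lam0 w)).
  by apply: le_trans (lamphi w) (ler_norm _).
have splitE w : ((phi 0%N w)%:E - ell w = (phi 0%N w - lam w)%:E + ell^\- w)%E.
  have -> : (ell w = (lam w)%:E - ell^\- w)%E.
    by have := congr1 (@^~ w) (funeposneg ell); rewrite ellp.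
  case: (ell^\- w)%E (funeneg_ge0 ell w) => [r| |] // _.
  by rewrite -!EFinB -EFinD; congr EFin; ring.
have aboveInt : ((\int[P]_w phi 0%N w)%:E < \int[P]_w ((phi 0%N w)%:E - ell
  w))%E.
  rewrite (_ : (\int[P]_w _)%E = A + \int[P]_w ell^\- w)%E; last first.
    rewrite -ge0_integralD //.
    - by apply: eq_integral => w _; exact: splitE.
    - by move=> w _; rewrite lee_fin subr_ge0; exact: lamphi.
    - by apply/measurable_EFinP; apply: measurable_funB.
    - exact: measurable_funeneg.
  have AE : A = (\int[P]_w phi 0%N w - \int[P]_w lam w)%:E.
    rewrite -RintegralB // -EFin_Rintegral //.
    by have := integrableB measurableT phi0i lami; apply: eq_integrable.
  have lamE : (\int[P]_w ell^\+ w = (\int[P]_w lam w)%:E)%E.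
    by rewrite -EFin_Rintegral //; apply: eq_integral => w _; rewrite ellp.
  move: Lneg; rewrite integralE -/ell lamE AE.
  have : (0 <= \int[P]_w ell^\- w)%E by apply: integral_ge0.
  case: (\int[P]_w ell^\- w)%E => [r| |] // _; last by rewrite ltry.
  by rewrite -EFinB -EFinD !lte_fin; lra.
pose g k w := (phi 0%N w - phi k w)%:E.
have gnd w : {homo g ^~ w : i j / (i <= j)%N >-> (i <= j)%E}.
  by move=> i j ij; rewrite lee_fin lerD2l lerN2 phimono.
have glim w : limn (g ^~ w) = ereal_sup (range (g ^~ w)).
  by apply/cvg_lim => //; exact: ereal_nondecreasing_cvgn.
have gcv : (\int[P]_w g k w)%E @[k --> \oo] --> (\int[P]_w limn (g ^~ w))%E.
  apply: cvg_monotone_convergence => //.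
  - by move=> k; apply/measurable_EFinP; apply: measurable_funB.
  - by move=> k w _; rewrite lee_fin subr_ge0 phimono.
have limge w : ((phi 0%N w)%:E - ell w <= limn (g ^~ w))%E.
  rewrite glim leNgt; apply/negP => below.
  have gle k : (g k w <= ereal_sup (range (g ^~ w)))%E.
    by apply: ereal_sup_ubound; exists k.
  case: ereal_sup gle below => [r| |] gle.
  - move=> below; have [a ar La] : exists2 a, a < phi 0%N w - r & L w < expR a.
      have [L1|L1] := leP (L w) 0.
        by exists (phi 0%N w - r - 1); [lra|exact: le_lt_trans L1 (expR_gt0 _)].
      move: below; rewrite /ell lne_EFin // -EFinB lte_fin => below.
      exists ((ln (L w) + (phi 0%N w - r)) / 2); first by lra.
      by rewrite -[ltLHS]lnK ?posrE // ltr_expR; lra.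
    have [k] := phiL w _ La; rewrite expRK => ka.
    by have := gle k; rewrite lee_fin; lra.
  - by rewrite ltNge leey.
  - by have := gle 0%N; rewrite leeNy_eq.
apply: contrapT => none.
have gint k : (\int[P]_w g k w <= (\int[P]_w phi 0%N w)%:E)%E.
  have gi : P.-integrable setT (EFin \o (fun w => phi 0%N w - phi k w)).
    by have := integrableB measurableT phi0i (phii k); apply: eq_integrable.
  rewrite /g EFin_Rintegral // lee_fin RintegralB // lerBlDr lerDl.
  by rewrite leNgt; apply/negP => neg; apply: none; exists k.
have : (\int[P]_w limn (g ^~ w) <= (\int[P]_w phi 0%N w)%:E)%E.
  rewrite -(cvg_lim _ gcv) //; apply: lime_le; first by apply/cvg_ex; eexists;
    exact: gcv.
  exact: nearW.
apply/negP; rewrite -ltNge; apply: (lt_le_trans aboveInt).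
apply: le_integral_ge0 => w //.
rewrite splitE; apply: adde_ge0; last exact: funeneg_ge0.
by rewrite lee_fin subr_ge0; exact: lamphi.
Qed.

End integral_comparisons.

(** * Contraction on small balls of parameters *)

Section logarithms.
Context {R : realType}.

Lemma logp_ge0 (x : R) : (0 <= logp x)%E.
Proof. by rewrite /logp le_max lexx orbT. Qed.

Lemma le_expR_of_logp (x l : R) : (logp x <= l%:E)%E -> x <= expR l.
Proof.
rewrite /logp ge_max => /andP[H _]; have [x0|x0] := leP x 0.
  exact: le_trans x0 (expR_ge0 _).
move: H; rewrite lne_EFin // lee_fin => H.
by rewrite -[leLHS]lnK ?posrE // ler_expR.
Qed.

Lemma ln_le_expR (x l : R) : 0 < x -> x <= expR l -> ln x <= l.
Proof. by move=> x0 xl; rewrite -[leRHS]expRK ler_ln // posrE expR_gt0. Qed.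

End logarithms.

Lemma iter_preserving {d} {S : measurableType d} {R : realType}
    (mu : probability S R) (tau : S -> S) k :
  measure_preserving mu tau -> measure_preserving mu (iter k tau).
Proof.
move=> tau_mp; split; first exact: (iter_measurable tau_mp).
elim: k => [//|k IH] A mA.
rewrite (_ : iter k.+1 tau @^-1` A = iter k tau @^-1` (tau @^-1` A)) //.
have mtA : measurable (tau @^-1` A).
  by rewrite -[X in measurable X]setTI; exact: tau_mp.1.
by rewrite IH // tau_mp.2.
Qed.

Section contraction_near_parameter.
Context {d : measure_display} {Omega : measurableType d} {R : realType}.
Variable P : probability Omega R.
Context {n : nat} {F T : metricType R} {h : 'M[R]_n -> F} {p : nat}.
Variables (Theta : set T) (dE : state p h -> state p h -> R).
Variable phi : int -> Omega -> state p h -> T -> state p h.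
Variable Lam : nat -> int -> Omega -> T -> R.

Local Notation S := (orbit_space (map_cylinders Theta (p := p)) phi).

Hypothesis dE_product : product_metric dE.
Hypothesis dE_separable : dist_separable dE.
Hypothesis Theta_compact : compact Theta.
Hypothesis phi_stationary : stationary P (map_cylinders Theta (p := p)) phi.
Hypothesis phi_ergodic : ergodic P (map_cylinders Theta (p := p)) phi.
Hypothesis phi_continuous : forall t w x j,
  {within Theta, continuous (fun theta => \val (phi t w x theta j) : F)}.
Hypothesis CI : cond_CI P Theta dE phi Lam.

Local Notation mu := (orbit_law phi_stationary).

Let Lam_continuous := lip_continuous (CI_bounds CI).
Let Lam_bound := lip_bound (CI_bounds CI).

Lemma closed_ball_compact theta e : compact (closed_ball_in Theta theta e).
Proof.
rewrite (_ : closed_ball_in _ _ _ = Theta `&` [set theta' | mdist theta theta'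
  <= e]) //.
apply: compact_closedI => //; rewrite -[X in closed X]setCK;
  apply: open_closedC.
rewrite openE => x /= /negP; rewrite -ltNge => ex; apply/nbhs_ballP.
exists (mdist theta x - e); first by rewrite /= subr_gt0.
move=> y; rewrite ballEmdist /= => xy; apply/negP; rewrite -ltNge.
by have := metric_triangle theta y x; rewrite (metric_sym y x); lra.
Qed.

Lemma closed_ball_center theta e : Theta theta -> 0 < e ->
  closed_ball_in Theta theta e theta.
Proof. by move=> Ht e0; split; rewrite ?mdistxx // ltW. Qed.

Lemma closed_ball_sub theta e : closed_ball_in Theta theta e `<=` Theta.
Proof. by move=> ? []. Qed.

(** The contraction condition holds pointwise in the parameter; continuity of
    the bound and monotone convergence extend it to small balls. *)
Lemma contraction_ball theta : Theta theta ->
  exists2 e, 0 < e & exists (r : nat) (b : S -> R),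
  [/\ (0 < r)%N, mu.-integrable setT (EFin \o b), \int[mu]_s b s < 0 &
      forall s, sup_lip dE (closed_ball_in Theta theta e) r s <= expR (b s)].
Proof.
move=> Ht; have [r r0 [neg fin]] := CI_contraction CI.
pose rad (k : nat) : R := k.+1%:R^-1.
have rad0 k : 0 < rad k by rewrite invr_gt0.
pose K k := closed_ball_in Theta theta (rad k).
have KT k : K k `<=` Theta by exact: closed_ball_sub.
have Kc k : compact (K k) by exact: closed_ball_compact.
have Kn k : K k !=set0 by exists theta; exact: closed_ball_center.
pose rho k (s : S) := sup_lip dE (K k) r s.
have mrho k : measurable_fun setT (rho k).
  exact: (sup_lip_measurable dE_product dE_separable Theta_compact
    phi_continuous Lam_continuous Lam_bound).
pose rho0 k (w : Omega) := rho k (0, w).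
have mrho0 k : measurable_fun setT (rho0 k).
  exact: (measurableT_comp (mrho k) (at_time0_measurable phi_stationary)).
pose L w := Lam r 0 w theta.
have L0 w : 0 <= L w by exact: (lip_ge0 (CI_bounds CI)).
have mL : measurable_fun setT L.
  apply: measurable_of_gt => a.
  have := (lip_stationary (CI_bounds CI) r0).1 0 [set f | `]a,
    +oo[%classic (f theta)].
  rewrite (_ : _ @^-1` _ = [set w | a < L w]).
    by apply; exists theta, `]a, +oo[%classic; split=> //;
      exact: measurable_itv.
  by apply/seteqP; split=> w; rewrite /= in_itv /= andbT.
(* Including [L w] makes the limit of [psi k w] exactly [log (L w)], and the
   truncation level is tied to the radius, so that one limit serves both. *)
pose psi k w := ln (Num.max (Num.max (rho0 k w) (L w)) (expR (- k%:R))).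
have pos k x : 0 < Num.max x (expR (- k%:R)) :> R by rewrite lt_max expR_gt0
  orbT.
have mpsi k : measurable_fun setT (psi k).
  apply: (measurableT_comp (@measurable_ln R)); apply: measurable_maxr => //.
  exact: measurable_maxr.
pose sup_log w := ereal_sup [set logp (Lam r 0 w theta') | theta' in Theta].
have sup_log0 w : (0 <= sup_log w)%E.
  apply: (le_trans (logp_ge0 (L w))); apply: ereal_sup_ubound; by exists theta.
have Lam_le w l theta' : (sup_log w <= l%:E)%E -> Theta theta' ->
    Lam r 0 w theta' <= expR l.
  move=> H Ht'; apply: le_expR_of_logp; apply: le_trans H.
  by apply: ereal_sup_ubound; exists theta'.
have rho_le w k B : 0 <= B -> (forall theta', K k theta' ->
  Lam r 0 w theta' <= B) ->
    rho0 k w <= B.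
  by move=> B0 HB; apply: (sup_lip_le_Lam dE_product Theta_compact
    Lam_continuous Lam_bound).
have psi0_ge0 w : 0 <= psi 0%N w.
  by apply: ln_ge0; rewrite oppr0 expR0 le_max lexx orbT.
have psi0_le w : ((psi 0%N w)%:E <= sup_log w)%E.
  have := sup_log0 w; have := Lam_le w.
  case: (sup_log w) => [l| |] // H l0; last by rewrite leey.
  rewrite lee_fin; apply: ln_le_expR => //; rewrite !ge_max; apply/andP; split.
    apply/andP; split; last exact: H.
    by apply: rho_le; [exact: expR_ge0|move=> theta' /KT; exact: H].
  by rewrite oppr0 ler_expR.
have psi0i : P.-integrable setT (EFin \o psi 0%N).
  apply: (integrable_le_bound (g := sup_log) (c := 0)) => // w.
  by rewrite adde0 ger0_norm.
have psidec k w : psi k.+1 w <= psi k w.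
  rewrite /psi ler_ln ?posrE //; apply: le_max2.
    apply: le_max2 => //; apply: (sup_lip_le dE_product Theta_compact
      Lam_continuous Lam_bound (KT k.+1)).
      exact: (sup_lip_ge0 dE_product Theta_compact Lam_continuous Lam_bound (KT
        k)).
    move=> theta' x y [Ht' Hd].
    apply: (sup_lipP dE_product Theta_compact Lam_continuous Lam_bound (KT k)).
    split=> //; apply: (le_trans Hd).
    by rewrite lef_pV2 ?posrE // ler_nat.
  by rewrite ler_expR lerN2 ler_nat.
have psi_lam w : ln (Num.max (L w) 1) <= psi 0%N w.
  rewrite /psi oppr0 expR0 ler_ln ?posrE ?lt_max ?ltr01 ?orbT //.
  by apply: le_max2 => //; rewrite le_max lexx orbT.
have psiN k w : - k%:R <= psi k w.
  by rewrite -[leLHS]expRK ler_ln ?posrE ?expR_gt0 // le_max lexx orbT.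
have psiL w eta : L w < eta -> exists k, psi k w <= ln eta.
  move=> Leta; have eta0 : 0 < eta by exact: le_lt_trans Leta.
  have gap : 0 < eta - L w by rewrite subr_gt0.
  have [c c0 Hc] := within_continuous_dist (@Lam_continuous r 0 w r0) Ht gap.
  pose k := maxn (Num.trunc c^-1) (Num.trunc (- ln eta)).+1; exists k.
  have kc : rad k < c.
    rewrite -[ltRHS]invrK ltf_pV2 ?posrE ?invr_gt0 //.
    by apply: (lt_le_trans (truncnS_gt _)); rewrite ler_nat ltnS leq_maxl.
  rewrite /psi ler_ln ?posrE // !ge_max (ltW Leta) andbT; apply/andP; split.
    apply: rho_le; first exact: ltW.
    move=> theta' [Ht' Hd].
    have := Hc _ Ht' (le_lt_trans Hd kc); rewrite /ball /= ltr_distlC.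
    by move=> /andP[_ /ltW]; rewrite -/(L w) addrC subrK.
  rewrite -[leRHS]lnK ?posrE // ler_expR lerNl.
  apply: (le_trans (ltW (truncnS_gt _))); rewrite ler_nat; exact: leq_maxr.
have [k [psiki psikneg]] :=
  integral_neg_approx mL L0 mpsi psidec psi_lam psiN psiL psi0i (neg theta Ht).
exists (rad k) => //.
pose b (s : S) := ln (Num.max (rho k s) (expR (- k%:R))); exists r, b.
have mb : measurable_fun setT b.
  by apply: (measurableT_comp (@measurable_ln R)); apply: measurable_maxr.
have b_le w : b (0, w) <= psi k w.
  rewrite /b /psi ler_ln ?posrE //; apply: le_max2 => //.
  by rewrite le_max lexx.
have b_ge w : - k%:R <= b (0, w).
  by rewrite -[leLHS]expRK ler_ln ?posrE ?expR_gt0 // le_max lexx orbT.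
have mb0 : measurable_fun setT (fun w => b (0, w)).
  exact: (measurableT_comp mb (at_time0_measurable phi_stationary)).
have bi : P.-integrable setT (EFin \o (fun w => b (0, w))).
  apply: (integrable_le_bound (g := sup_log) (c := k%:R)) => // w.
  have psik0 : psi k w <= psi 0%N w.
    by elim: (k) => [//|j IH]; exact: le_trans (psidec j w) IH.
  apply: (@le_trans _ _ ((psi 0%N w)%:E + k%:R%:E)%E); last exact: leeD2r.
  rewrite -EFinD lee_fin ler_norml.
  have := b_le w; have := b_ge w; have := psi0_ge0 w; have := ler0n R k.
  by move=> *; apply/andP; split; lra.
have [bi' bE] := integrable_orbit_law phi_stationary mb bi.
split => //.
  rewrite bE; apply: le_lt_trans psikneg; exact: le_Rintegral.
by move=> s; rewrite /b lnK ?posrE // le_max lexx.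
Qed.

(** Composing into the past is a cocycle over the backward shift. *)
Lemma backward_decay theta e (r : nat) (b : S -> R) : Theta theta -> 0 < e ->
  (0 < r)%N -> mu.-integrable setT (EFin \o b) -> \int[mu]_s b s < 0 ->
  (forall s, sup_lip dE (closed_ball_in Theta theta e) r s <= expR (b s)) ->
  exists2 C : R, 0 < C & \forall s \ae mu, exists2 A, 0 <= A & forall k,
    sup_lip dE (closed_ball_in Theta theta e) k s <= A * expR (- (C * k%:R)).
Proof.
move=> Ht e0 r0 bi bneg rb.
have KT : closed_ball_in Theta theta e `<=` Theta by exact: closed_ball_sub.
apply: (cocycle_decay (advanceN1_preserving phi_stationary)
  (advanceN1_ergodic phi_stationary phi_ergodic)
  (c := sup_lip dE (closed_ball_in Theta theta e)) r0 _ _ _ rb) => //.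
- move=> k; apply: (sup_lip_measurable dE_product dE_separable Theta_compact
    phi_continuous Lam_continuous Lam_bound KT (@closed_ball_compact theta e)).
  by exists theta; exact: closed_ball_center.
- move=> k s; exact: (sup_lip_ge0 dE_product Theta_compact Lam_continuous
    Lam_bound KT).
- move=> i j s; rewrite iter_advance mulNrn natz.
  exact: (sup_lipD dE_product Theta_compact Lam_continuous Lam_bound KT).
Qed.

(** The composition of the maps of the times [1, ..., k] is seen from the moving
    time [k]; it is a cocycle over the forward shift. *)
Lemma forward_decay theta e (r : nat) (b : S -> R) : Theta theta -> 0 < e ->
  (0 < r)%N -> mu.-integrable setT (EFin \o b) -> \int[mu]_s b s < 0 ->
  (forall s, sup_lip dE (closed_ball_in Theta theta e) r s <= expR (b s)) ->
  exists2 C : R, 0 < C & \forall s \ae mu, exists2 A, 0 <= A & forall k : nat,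
    sup_lip dE (closed_ball_in Theta theta e) k (advance k%:Z s) <=
    A * expR (- (C * k%:R)).
Proof.
move=> Ht e0 r0 bi bneg rb.
have KT : closed_ball_in Theta theta e `<=` Theta by exact: closed_ball_sub.
have tau_r := iter_preserving r (advance1_preserving phi_stationary).
apply: (cocycle_decay (advance1_preserving phi_stationary)
  (advance1_ergodic phi_stationary phi_ergodic)
  (c := fun k s => sup_lip dE (closed_ball_in Theta theta e) k (advance k%:Z s))
  (b := b \o iter r (advance 1)) r0).
- move=> k; apply: measurableT_comp; last exact: advance_measurable.
  apply: (sup_lip_measurable dE_product dE_separable Theta_compact
    phi_continuous Lam_continuous Lam_bound KT (@closed_ball_compact theta e)).
  by exists theta; exact: closed_ball_center.
- move=> k s; exact: (sup_lip_ge0 dE_product Theta_compact Lam_continuous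
    Lam_bound KT).
- move=> i j s; rewrite iter_advance natz advanceD mulrC.
  have := sup_lipD dE_product Theta_compact Lam_continuous Lam_bound KT
    j i (advance (i + j)%:Z s).
  by rewrite advanceD PoszD addrK addnC.
- by move=> s; rewrite /= iter_advance natz; exact: rb.
- exact: integrable_comp.
- by rewrite (Rintegral_comp tau_r bi).
Qed.

Definition displacement (y : state p h) (s : S) : R :=
  sup [set dE (phi s.1 s.2 y theta) y | theta in Theta].

Definition log_displacement (y : state p h) (s : S) : R :=
  ln (Num.max 1 (displacement y s)).

Lemma displacement_has_ubound y s :
  has_ubound [set dE (phi s.1 s.2 y theta) y | theta in Theta].
Proof.
have cont : {within Theta, continuous (fun theta =>
  dE (phi s.1 s.2 y theta) y)}.
  apply: dist_within_continuous => theta Ht e e0.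
  have [c c0 Hc] := phi_continuous_dE dE_product phi_continuous s.1 s.2 y Ht e0.
  exists c => // theta' Ht' /(Hc _ Ht') H; rewrite /ball /=.
  apply: le_lt_trans H; rewrite ler_norml.
  have := dE_triangle dE_product (phi s.1 s.2 y theta) (phi s.1 s.2 y theta') y.
  have := dE_triangle dE_product (phi s.1 s.2 y theta') (phi s.1 s.2 y theta) y.
  rewrite (dE_sym dE_product (phi s.1 s.2 y theta') (phi s.1 s.2 y theta)).
  by move=> *; apply/andP; split; lra.
have [B HB] := compact_bounded_above Theta_compact cont.
by exists B => _ [theta Ht <-]; exact: HB.
Qed.

Lemma displacementP y s theta : Theta theta ->
  dE (phi s.1 s.2 y theta) y <= expR (log_displacement y s).
Proof.
move=> Ht; rewrite /log_displacement lnK ?posrE ?lt_max ?ltr01 // le_max.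
apply/orP; right; apply: ub_le_sup; first exact: displacement_has_ubound.
by exists theta.
Qed.

Lemma log_displacement_integrable y : Theta !=set0 ->
  (\int[P]_w ereal_sup [set logp (dE (phi 0%R w y theta) y) | theta in Theta] <
    +oo)%E ->
  mu.-integrable setT (EFin \o log_displacement y).
Proof.
move=> Tn fin; have [v Tv vdense] := compact_dense_sequence Theta_compact Tn.
have [theta0 Ht0] := Tn.
have mdisp : measurable_fun setT (displacement y).
  apply: measurable_of_gt => a.
  rewrite [X in measurable X](_ : _ = [set s : S | exists k : nat,
      a < dE (phi s.1 s.2 y (v k)) y]).
    apply: measurable_ex => k; apply: measurable_gt;
      apply: (random_state_dE dE_product
      dE_separable (U := fun s : S => phi s.1 s.2 y (v k)) (V := fun=> y)).
      exact: phi_random_state.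
    exact: random_state_cst.
  apply/seteqP; split=> s /=; last first.
    move=> [k ak]; apply: (lt_le_trans ak); apply: ub_le_sup.
      exact: displacement_has_ubound.
    by exists (v k).
  move=> /sup_gt[|_ [theta Ht <-] gap];
    first by exists (dE (phi s.1 s.2 y theta0) y), theta0.
  have gap0 : 0 < dE (phi s.1 s.2 y theta) y - a by rewrite subr_gt0.
  have [c c0 Hc] := phi_continuous_dE dE_product phi_continuous s.1 s.2 y Ht
    gap0.
  have [k Hk] := vdense theta c Ht c0; exists k.
  have := Hc _ (Tv k) Hk.
  have := dE_triangle dE_product (phi s.1 s.2 y theta) (phi s.1 s.2 y (v k)) y.
  lra.
have mlog : measurable_fun setT (log_displacement y).
  apply: (measurableT_comp (@measurable_ln R)); exact: measurable_maxr.
have mlog0 : measurable_fun setT (fun w => log_displacement y (0, w)).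
  exact: (measurableT_comp mlog (at_time0_measurable phi_stationary)).
pose sup_log w := ereal_sup [set logp (dE (phi 0%R w y theta) y) | theta in
  Theta].
have sup_log0 w : (0 <= sup_log w)%E.
  apply: (le_trans (logp_ge0 (dE (phi 0%R w y theta0) y))).
  by apply: ereal_sup_ubound; exists theta0.
suff /(integrable_orbit_law phi_stationary mlog)[] : P.-integrable setT
  (EFin \o (fun w => log_displacement y (0, w))) by [].
apply: (integrable_le_bound (g := sup_log) (c := 0)) => // w.
have ld0 : 0 <= log_displacement y (0, w) by apply: ln_ge0; rewrite le_max lexx.
rewrite adde0 ger0_norm //; have := sup_log0 w.
have : forall l, (sup_log w <= l%:E)%E -> forall theta, Theta theta ->
    dE (phi 0%R w y theta) y <= expR l.
  move=> l H theta Ht; apply: le_expR_of_logp; apply: le_trans H.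
  by apply: ereal_sup_ubound; exists theta.
case: (sup_log w) => [l| |] // H l0; last by rewrite leey.
rewrite lee_fin; apply: ln_le_expR; first by rewrite lt_max ltr01.
rewrite ge_max -expR0 ler_expR -lee_fin l0 /=.
apply: sup_le_ub; first by exists (dE (phi 0 w y theta0) y), theta0.
by move=> _ [theta Ht <-]; exact: (H l (lexx _)).
Qed.

End contraction_near_parameter.

(** * The stationary solution *)

Section exponential_sequences.
Context {R : realType}.

Lemma exp_decay_small (A c e : R) : 0 < c -> 0 < e ->
  exists n0, forall n, (n0 <= n)%N -> A * expR (- (c * n%:R)) < e.
Proof.
move=> c0 e0; pose B := `|A| + 1; have B0 : 0 < B by rewrite ltr_wpDl.
exists (Num.trunc (ln (B / e) / c)).+1 => n nn.
apply: (@lt_le_trans _ _ (B * expR (- (c * n%:R)))).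
  rewrite ltr_pM2r ?expR_gt0 //; apply: (le_lt_trans (ler_norm A)).
  by rewrite ltrDl.
rewrite expRN ler_pdivrMr ?expR_gt0 // -ler_pdivrMl // mulrC.
rewrite -[leLHS]lnK ?posrE ?divr_gt0 // ler_expR [c * _]mulrC -ler_pdivrMr //.
by apply: (le_trans (ltW (truncnS_gt _))); rewrite ler_nat.
Qed.

Lemma exp_decay_weaken (A c c' : R) n : 0 <= A -> c' <= c ->
  A * expR (- (c * n%:R)) <= A * expR (- (c' * n%:R)).
Proof. by move=> A0 cc; rewrite ler_wpM2l // ler_expR lerN2 ler_wpM2r. Qed.

End exponential_sequences.

Section state_sequences.
Context {R : realType} {F : metricType R} {M : pointedType} {h : M ->
  F} {p : nat}.
Variable dE : state p h -> state p h -> R.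
Hypothesis dE_product : product_metric dE.

Definition converges (u : nat -> state p h) (l : state p h) : Prop :=
  forall e, 0 < e -> exists n0, forall n, (n0 <= n)%N -> dE (u n) l < e.

(** The fixed value off the set of convergence makes the limit measurable and
    the same functional of the path at all times. *)
Definition seq_limit (y : state p h) (u : nat -> state p h) : state p h :=
  if pselect (exists l, converges u l) is left cv then projT1 (cid cv) else y.

Lemma seq_limitP y u l : converges u l -> converges u (seq_limit y u).
Proof.
move=> ul; rewrite /seq_limit; case: pselect => [cv|]; last by case; exists l.
exact: (projT2 (cid cv)).
Qed.

Lemma converges_unique u l l' : converges u l -> converges u l' -> l = l'.
Proof.
move=> ul ul'; apply: (dE_eq0 dE_product); apply/eqP.
rewrite eq_le (dE_ge0 dE_product) andbT; apply/ler_addgt0Pr => e e0.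
have [n0 H] := ul _ (divr_gt0 e0 (ltr0n R 2)).
have [n1 H'] := ul' _ (divr_gt0 e0 (ltr0n R 2)).
have h1 := H (maxn n0 n1) (leq_maxl _ _).
have h2 := H' (maxn n0 n1) (leq_maxr _ _).
apply: (le_trans (dE_triangle dE_product l (u (maxn n0 n1)) l')).
by rewrite (dE_sym dE_product l); lra.
Qed.

Lemma converges_shift u l : converges u l -> converges (fun n => u n.+1) l.
Proof.
by move=> ul e e0; have [n0 H] := ul e e0; exists n0 => n nn; apply: H;
  exact: leqW.
Qed.

Lemma dE_limit_le u l x B : converges u l ->
  (exists n0, forall n, (n0 <= n)%N -> dE x (u n) <= B) -> dE x l <= B.
Proof.
move=> ul [n0 H]; apply/ler_addgt0Pr => e e0; have [n1 H1] := ul e e0.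
apply: (le_trans (dE_triangle dE_product x (u (maxn n0 n1)) l)).
by apply: lerD; [apply: H; exact: leq_maxl|apply/ltW/H1; exact: leq_maxr].
Qed.

Lemma exp_decay_sum (u : nat -> state p h) (A c : R) : 0 < c ->
  (forall n, dE (u n) (u n.+1) <= A * expR (- (c * n%:R))) ->
  forall n m, (n <= m)%N ->
    dE (u n) (u m) <= A / (1 - expR (- c)) * expR (- (c * n%:R)).
Proof.
move=> c0 H n m nm; have A0 : 0 <= A.
  by have := H 0%N; rewrite mulr0 oppr0 expR0 mulr1;
    apply: le_trans (dE_ge0 dE_product _ _).
have q1 : 0 < 1 - expR (- c) by rewrite subr_gt0 expR_lt1 oppr_lt0.
suff HS k : dE (u n) (u (n + k)%N) <=
    A / (1 - expR (- c)) * (expR (- (c * n%:R)) - expR (- (c * (n + k)%:R))).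
  rewrite -(subnKC nm); apply: (le_trans (HS _)).
  by rewrite ler_wpM2l ?divr_ge0 ?(ltW q1) // gerDl oppr_le0 expR_ge0.
elim: k => [|k IH]; first by rewrite addn0 (dExx dE_product) subrr mulr0.
apply: (le_trans (dE_triangle dE_product _ (u (n + k)%N) _)).
rewrite addnS; apply: (le_trans (lerD IH (H _))).
have -> : expR (- (c * (n + k).+1%:R)) = expR (- (c * (n + k)%:R)) * expR (- c).
  by rewrite -expRD -natr1 mulrDr mulr1 opprD.
set E := expR (- (c * (n + k)%:R)); set E0 := expR (- (c * n%:R)).
rewrite le_eqVlt; apply/orP; left; apply/eqP.
by field; rewrite gt_eqF.
Qed.

Hypothesis dE_complete : dist_complete dE.

Lemma cauchy_converges (u : nat -> state p h) :
  (forall e, 0 < e -> exists m, forall i j, (m <= i)%N -> (m <= j)%N ->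
     dE (u i) (u j) < e) -> exists l, converges u l.
Proof.
move=> /dE_complete[l ul]; exists l => e e0.
have /cvgrPdist_lt /(_ e e0)[n0 _ H] := ul; exists n0 => n /H.
by rewrite /= sub0r normrN ger0_norm // (dE_ge0 dE_product).
Qed.

End state_sequences.

Section stationary_solutions.
Context {d : measure_display} {Omega : measurableType d} {R : realType}.
Variable P : probability Omega R.
Context {n : nat} {F T : metricType R} {h : 'M[R]_n -> F} {p : nat}.
Variables (Theta : set T) (dE : state p h -> state p h -> R).
Variable phi : int -> Omega -> state p h -> T -> state p h.
Variable Lam : nat -> int -> Omega -> T -> R.

Local Notation S := (orbit_space (map_cylinders Theta (p := p)) phi).

Hypothesis dE_product : product_metric dE.
Hypothesis dE_separable : dist_separable dE.
Hypothesis dE_complete : dist_complete dE.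
Hypothesis Theta_compact : compact Theta.
Hypothesis phi_stationary : stationary P (map_cylinders Theta (p := p)) phi.
Hypothesis phi_ergodic : ergodic P (map_cylinders Theta (p := p)) phi.
Hypothesis phi_continuous : forall t w x j,
  {within Theta, continuous (fun theta => \val (phi t w x theta j) : F)}.
Hypothesis phi_shift : forall t w x theta (i j : 'I_p), Theta theta ->
  nat_of_ord j = i.+1 -> phi t w x theta i = x j.
Hypothesis CI : cond_CI P Theta dE phi Lam.

Local Notation mu := (orbit_law phi_stationary).

Let Lam_continuous := lip_continuous (CI_bounds CI).
Let Lam_bound := lip_bound (CI_bounds CI).

Variable y : state p h.
Hypothesis y_logmoment :
  (\int[P]_w ereal_sup [set logp (dE (phi 0%R w y theta) y) | theta in Theta]
    < +oo)%E.

Definition backward (k : nat) (theta : T) (s : S) : state p h :=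
  orbit_iter k theta s y.

Definition exp_cauchy_on (K : set T) (s : S) : Prop :=
  exists A c, [/\ 0 <= A, 0 < c & forall theta i j, K theta -> (i <= j)%N ->
    dE (backward i theta s) (backward j theta s) <= A * expR (- (c * i%:R))].

(** The first decay is for the convergence of the backward iterates and for
    uniqueness, the second one for forgetting the values at a fixed time. *)
Record contracting_at (K : set T) (C : R) (s : S) : Prop := {
  contracting_past : exists2 A, 0 <= A & forall k,
    sup_lip dE K k s <= A * expR (- (C * k%:R)) ;
  contracting_future : exists2 A, 0 <= A & forall k : nat,
    sup_lip dE K k (advance k%:Z s) <= A * expR (- (C * k%:R)) ;
  contracting_cauchy : exp_cauchy_on K s }.

(** Consecutive backward iterates differ by the Lipschitz coefficient of [i]
    maps times a displacement at time [- i]. By the ergodic theorem the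
    logarithm of the displacement is sublinear in [i], so it uses up at most
    half of the rate. *)
Lemma contracting_ball theta : Theta theta ->
  exists2 e, 0 < e & exists2 C, 0 < C & \forall s \ae mu, forall t : int,
    contracting_at (closed_ball_in Theta theta e) C (advance t s).
Proof.
move=> Ht; have [e e0 [r [b [r0 bi bneg rb]]]] := contraction_ball dE_product
  dE_separable Theta_compact phi_stationary phi_continuous CI Ht.
exists e => //; pose K := closed_ball_in Theta theta e.
have KT : K `<=` Theta by exact: closed_ball_sub.
have [C1 C10 past] := backward_decay dE_product dE_separable Theta_compact
  phi_ergodic phi_continuous CI Ht e0 r0 bi bneg rb.
have [C2 C20 future] := forward_decay dE_product dE_separable Theta_compact
  phi_ergodic phi_continuous CI Ht e0 r0 bi bneg rb.
exists (Num.min C1 C2); first by rewrite lt_min C10.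
apply: ae_orbit.
have Tn : Theta !=set0 by exists theta.
have di := log_displacement_integrable dE_product dE_separable Theta_compact
  phi_stationary phi_continuous Tn y_logmoment.
have := birkhoff_mean (advanceN1_preserving phi_stationary)
  (advanceN1_ergodic phi_stationary phi_ergodic) di.
move: past future; apply: filterS3 => s [A1 A10 H1] [A2 A20 H2] mean.
split.
- exists A1 => // k; apply: (le_trans (H1 k)); apply: exp_decay_weaken => //.
  by rewrite ge_min lexx.
- exists A2 => // k; apply: (le_trans (H2 k)); apply: exp_decay_weaken => //.
  by rewrite ge_min lexx orbT.
have C12 : 0 < C1 / 2 by rewrite divr_gt0.
have [B B0 HB] := mean_to_term mean C12.
exists (A1 * expR B / (1 - expR (- (C1 / 2)))), (C1 / 2); split => //.
  by rewrite divr_ge0 ?mulr_ge0 ?expR_ge0 // subr_ge0 expR_le1 oppr_le0 ltW.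
move=> theta' i j Kt; apply: (exp_decay_sum dE_product (u := fun k =>
  backward k theta' s)) => // {}i.
rewrite /backward -addn1 orbit_iterD.
apply: (le_trans (sup_lipP dE_product Theta_compact Lam_continuous Lam_bound KT
  _ _ _ _ Kt)).
have -> : A1 * expR B * expR (- (C1 / 2 * i%:R)) =
    A1 * expR (- (C1 * i%:R)) * expR (B + C1 / 2 * i%:R).
  by rewrite -!mulrA -!expRD; congr (_ * expR _); field.
apply: ler_pM.
- exact: (sup_lip_ge0 dE_product Theta_compact Lam_continuous Lam_bound KT).
- exact: dE_ge0.
- exact: H1.
rewrite (dE_sym dE_product).
have := displacementP dE_product Theta_compact phi_continuous y
  (advance (- i%:Z) s) (KT _ Kt).
rewrite /orbit_iter /= => /le_trans; apply; rewrite ler_expR.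
have := HB i; rewrite iter_advance mulNrn natz.
by apply: le_trans; exact: ler_norm.
Qed.

Definition solution (theta : T) (s : S) : state p h :=
  seq_limit dE y (fun k => backward k theta s).

Lemma solution_exp_cvg K s : exp_cauchy_on K s ->
  exists A c, [/\ 0 <= A, 0 < c & forall theta i, K theta ->
    dE (backward i theta s) (solution theta s) <= A * expR (- (c * i%:R))].
Proof.
move=> [A [c [A0 c0 H]]]; exists A, c; split => // theta i Kt.
have cv : converges dE (fun k => backward k theta s) (solution theta s).
  suff [l] : exists l, converges dE (fun k => backward k theta s) l.
    exact: seq_limitP.
  apply: cauchy_converges => // e e0; have [n0 Hn0] := exp_decay_small A c0 e0.
  exists n0 => a b na nb; case: (leqP a b) => ab.
    exact: le_lt_trans (H _ _ _ Kt ab) (Hn0 _ na).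
  rewrite (dE_sym dE_product).
  exact: le_lt_trans (H _ _ _ Kt (ltnW ab)) (Hn0 _ nb).
apply: (dE_limit_le dE_product cv); exists i => j; exact: H.
Qed.

Lemma solution_cvg K s theta : exp_cauchy_on K s -> K theta ->
  converges dE (fun k => backward k theta s) (solution theta s).
Proof.
move=> /solution_exp_cvg[A [c [A0 c0 H]]] Kt e e0.
have [n0 Hn0] := exp_decay_small A c0 e0.
by exists n0 => k /Hn0; exact: le_lt_trans (H _ _ Kt).
Qed.

Lemma solution_random_state theta : Theta theta ->
  random_state (solution theta).
Proof.
move=> Ht.
have xr k : random_state (backward k theta).
  exact: (orbit_iter_random_state dE_product dE_separable Theta_compact
    Lam_continuous Lam_bound).
pose cauchy : set S := [set s | forall k : nat, exists m : nat,
  forall i j : nat,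
  dE (backward (m + i) theta s) (backward (m + j) theta s) < k.+1%:R^-1].
have mcauchy : measurable cauchy.
  apply: measurable_all => k; apply: measurable_ex => m.
  apply: measurable_all => i; apply: measurable_all => j.
  apply: measurable_lt_set; last exact: measurable_cst.
  exact: (random_state_dE dE_product dE_separable).
have cauchy_cvg s : cauchy s -> exists l, converges dE (fun k =>
  backward k theta s) l.
  move=> cs; apply: cauchy_converges => // e e0.
  have [m Hm] := cs (Num.trunc e^-1); exists m => i j mi mj.
  rewrite -(subnKC mi) -(subnKC mj); apply: (lt_le_trans (Hm _ _)).
  rewrite -[leRHS]invrK lef_pV2 ?posrE ?invr_gt0 //.
  by rewrite ltW // truncnS_gt.
apply: (random_state_limit dE_product
  (V := fun k s => if s \in cauchy then backward k theta s else y)).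
  by move=> k; apply: random_state_if => //; exact: random_state_cst.
move=> s; have [cs|ncs] := pselect (cauchy s).
  rewrite (mem_set cs).
  by have [l cv] := cauchy_cvg s cs; exact: (seq_limitP y cv).
rewrite (memNset ncs); suff -> : solution theta s = y.
  by move=> e e0; exists 0%N => k _; rewrite (dExx dE_product).
rewrite /solution /seq_limit; case: pselect => // -[l cv]; exfalso.
apply: ncs => k.
have k0 : 0 < k.+1%:R^-1 / 2 :> R by rewrite divr_gt0 // invr_gt0.
have [m Hm] := cv _ k0; exists m => i j.
apply: (le_lt_trans (dE_triangle dE_product _ l _)).
rewrite (dE_sym dE_product l) [ltRHS]splitr.
by apply: ltrD; apply: Hm; exact: leq_addr.
Qed.

Lemma solution_fixed s theta : Theta theta ->
  converges dE (fun k => backward k theta s) (solution theta s) ->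
  converges dE (fun k => backward k theta (advance (-1) s))
    (solution theta (advance (-1) s)) ->
  solution theta s = phi s.1 s.2 (solution theta (advance (-1) s)) theta.
Proof.
move=> Ht cv cvp; apply: (converges_unique dE_product (converges_shift cv)).
move=> e e0; have [L L0 HL] := orbit_iter_lip_unif dE_product Theta_compact
  Lam_continuous Lam_bound 1 s.
have L1 : 0 < L + 1 by rewrite ltr_wpDl.
have [n0 Hn0] := cvp _ (divr_gt0 e0 L1); exists n0 => k /Hn0.
rewrite ltr_pdivlMr // /backward orbit_iterS.
have := HL theta (orbit_iter k theta (advance (-1) s) y)
  (solution theta (advance (-1) s)) Ht.
have := dE_ge0 dE_product (orbit_iter k theta (advance (-1) s) y)
  (solution theta (advance (-1) s)).
rewrite {4 5}/orbit_iter /=.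
set a := dE _ _; set b := dE _ _; clearbody a b; lra.
Qed.

Hypothesis p_gt0 : (0 < p)%N.

Lemma last_index_subproof : (p.-1 < p)%N.
Proof. by rewrite prednK. Qed.

Definition last_index : 'I_p := Ordinal last_index_subproof.

Lemma window_last (u : int -> img h) t : window u t last_index = u t.
Proof.
rewrite /window /=; congr (u _); move: p_gt0; clear; lia.
Qed.

(** The overlap of consecutive windows makes the coordinates of a state
    solution the past values of its last coordinate. *)
Lemma window_of_states (G : int -> state p h) :
  (forall t (i j : 'I_p), nat_of_ord j = i.+1 -> G t i = G (t - 1) j) ->
  forall t, window (fun k => G k last_index) t = G t.
Proof.
move=> HG t; apply/funext => i; rewrite /window.
have : (p.-1 - i + i = p.-1)%N by rewrite subnK // -ltnS prednK.
move: (p.-1 - i)%N => k; elim: k i t => [|k IH] i t ki.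
  have -> : i = last_index by apply: val_inj; rewrite /= -ki.
  congr (G _ _); rewrite /=; move: p_gt0; clear; lia.
have ip : (i.+1 < p)%N by move: ki p_gt0; clear; lia.
rewrite (HG t i (Ordinal ip)) // -(IH (Ordinal ip) (t - 1)); last first.
  by rewrite /= addnS -addSn.
by congr (G _ _); rewrite /= intS; ring.
Qed.

Definition volatility (t : int) (theta : T) (w : Omega) : img h :=
  solution theta (t, w) last_index.

Lemma window_volatility theta w : Theta theta ->
  (forall t : int, converges dE (fun k =>
    backward k theta (t, w)) (solution theta (t, w))) ->
  (forall t, window (fun k => volatility k theta w) t = solution theta (t,
    w)) /\
  (forall t, window (fun k => volatility k theta w) t =
     phi t w (window (fun k => volatility k theta w) (t - 1)) theta).
Proof.
move=> Ht cv.
have fixed t : solution theta (t, w) = phi t w (solution theta (t - 1,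
  w)) theta.
  exact: (@solution_fixed (t, w) theta Ht (cv t) (cv (t - 1))).
have winE t : window (fun k => volatility k theta w) t = solution theta (t, w).
  apply: (window_of_states (G := fun k => solution theta (k, w))) => {}t i j ij.
  by rewrite fixed (phi_shift _ _ _ Ht ij).
by split=> // t; rewrite !winE.
Qed.

(** The backward iterates are continuous in the parameter and converge
    uniformly on the ball. *)
Lemma solution_continuous theta e s theta' :
  exp_cauchy_on (closed_ball_in Theta theta e) s ->
  Theta theta' -> mdist theta theta' < e -> forall c, 0 < c ->
  exists2 r, 0 < r & forall theta'', Theta theta'' ->
    mdist theta' theta'' < r ->
    dE (solution theta' s) (solution theta'' s) < c.
Proof.
move=> /solution_exp_cvg[A [a [A0 a0 H]]] Ht' tt' c c0.
have c4 : 0 < c / 4 by rewrite divr_gt0.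
have [k Hk] := exp_decay_small A a0 c4; have {Hk}Hk := Hk k (leqnn k).
have [r r0 Hr] := orbit_iter_continuous dE_product Theta_compact phi_continuous
  Lam_continuous Lam_bound k s y Ht' c4.
exists (Num.min r (e - mdist theta theta')).
  by rewrite lt_min r0 subr_gt0.
move=> theta'' Ht''; rewrite lt_min => /andP[t1 t2].
have K' : closed_ball_in Theta theta e theta' by split=> //; exact: ltW.
have K'' : closed_ball_in Theta theta e theta''.
  split=> //; apply: (le_trans (metric_triangle theta theta' theta'')); lra.
have := dE_quad dE_product (solution theta' s) (solution theta'' s)
  (backward k theta' s) (backward k theta'' s).
rewrite (dE_sym dE_product (solution theta' s) (backward _ _ _)).
rewrite (dE_sym dE_product (solution theta'' s) (backward _ _ _)).
have := H _ k K'; have := H _ k K''; have := Hr _ Ht'' t1;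
  rewrite -!/(backward _ _ _).
move: Hk; set E := A * _; clearbody E; lra.
Qed.

End stationary_solutions.

(** * Uniqueness, continuity and stability *)

Section tightness.
Context {d : measure_display} {Omega : measurableType d} {R : realType}.
Variable P : probability Omega R.

Definition tight (Y : nat -> Omega -> R) : Prop :=
  (forall k, measurable_fun setT (Y k)) /\
  forall e, 0 < e -> exists a, forall k, (P [set w | (a < Y k w)%R] <= e%:E)%E.

Lemma tight_identical (Y : nat -> Omega -> R) (Y0 : Omega -> R) :
  (forall k, measurable_fun setT (Y k)) -> measurable_fun setT Y0 ->
  (forall k a, P [set w | a < Y k w] = P [set w | a < Y0 w]) -> tight Y.
Proof.
move=> mY mY0 law; split=> // e e0; have [a Ha] := tail_small P mY0 e0.
by exists a => k; rewrite law ltW.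
Qed.

Lemma tight_add (Y Z : nat -> Omega -> R) :
  tight Y -> tight Z -> tight (fun k w => Y k w + Z k w).
Proof.
move=> [mY tY] [mZ tZ]; split=> [k|e e0]; first exact: measurable_funD.
have [a Ha] := tY _ (divr_gt0 e0 (ltr0n R 2)).
have [b Hb] := tZ _ (divr_gt0 e0 (ltr0n R 2)).
have mYa k : measurable [set w | a < Y k w] by exact: measurable_gt.
have mZb k : measurable [set w | b < Z k w] by exact: measurable_gt.
exists (a + b) => k.
apply: (@le_trans _ _ (P ([set w | (a < Y k w)%R] `|` [set w | (b < Z k
  w)%R]))).
  apply: le_measure; rewrite ?inE.
  - by apply: measurable_gt; exact: measurable_funD.
  - exact: measurableU.
  move=> w /=; have [Yw|Yw] := ltP a (Y k w); first by left.
  by move=> ab; right; lra.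
apply: (le_trans (measureU2 P (mYa k) (mZb k))).
by rewrite (splitr e) EFinD; apply: leeD; [exact: Ha|exact: Hb].
Qed.

Lemma tight_sum (I : Type) (s : seq I) (Y : I -> nat -> Omega -> R) :
  (forall i, tight (Y i)) -> tight (fun k w => \sum_(i <- s) Y i k w).
Proof.
move=> tY; elim: s => [|i s IH].
  rewrite (_ : (fun _ _ => _) = fun _ _ => 0); last first.
    by apply/funext => k; apply/funext => w; rewrite big_nil.
  by apply: (tight_identical (Y0 := fun=> 0)) => // *; exact: measurable_cst.
rewrite (_ : (fun _ _ => _) = fun k w => Y i k w + \sum_(i <- s) Y i k w).
  exact: tight_add.
by apply/funext => k; apply/funext => w; rewrite big_cons.
Qed.

Lemma tight_le (Y Z : nat -> Omega ->
  R) : (forall k, measurable_fun setT (Y k)) ->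
  (forall k w, Y k w <= Z k w) -> tight Z -> tight Y.
Proof.
move=> mY YZ [mZ tZ]; split=> // e e0; have [a Ha] := tZ e e0; exists a => k.
apply: le_trans (Ha k); apply: le_measure; rewrite ?inE;
  try exact: measurable_gt.
by move=> w /= /lt_le_trans; apply.
Qed.

(** The event that [Y k] exceeds [a] from some time on is an increasing union of
    events contained in [a < Y k] for single [k], so its probability is small
    for large [a]. *)
Lemma tight_recurrent (Y : nat -> Omega -> R) : tight Y ->
  \forall w \ae P, exists a, forall N, exists2 k, (N <= k)%N & Y k w <= a.
Proof.
move=> [mY tY].
pose B (a N : nat) := [set w | forall i : nat, a%:R < Y (N + i)%N w].
pose E (a : nat) := \bigcup_N B a N.
have mB a N : measurable (B a N).
  by apply: measurable_all => i; exact: measurable_gt.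
have mE a : measurable (E a) by exact: bigcup_measurable.
have small e : 0 < e -> exists a : nat, (P (E a) <= e%:E)%E.
  move=> e0; have [a0 Ha0] := tY e e0; pose a := (Num.trunc a0).+1; exists a.
  have Bnd : nondecreasing_seq (B a).
    move=> i j ij; apply/subsetPset => w Bw k.
    by rewrite -(subnKC ij) -addnA; exact: Bw.
  have := nondecreasing_cvg_mu (mu := P) (mB a) (mE a) Bnd.
  move=> cv; rewrite -(cvg_lim _ cv) //; apply: lime_le.
    by apply/cvg_ex; eexists; exact: cv.
  apply: nearW => N; apply: le_trans (Ha0 N); apply: le_measure;
    rewrite ?inE //.
    exact: measurable_gt.
  move=> w /(_ 0%N); rewrite addn0 /=; apply: lt_trans; exact: truncnS_gt.
exists (\bigcap_a E a); split.
- exact: bigcap_measurable.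
- apply/eqP; rewrite eq_le measure_ge0 andbT; apply/lee_addgt0Pr => e e0.
  have [a Ha] := small e e0; rewrite add0e; apply: le_trans Ha.
  apply: le_measure; rewrite ?inE //; first exact: bigcap_measurable.
  by move=> w /(_ a); apply.
- move=> w /= nrec a _; apply: contrapT => nE; apply: nrec; exists a%:R => N.
  apply: contrapT => none; apply: nE; exists N => // i.
  rewrite ltNge; apply/negP => Yi; apply: none; exists (N + i)%N => //.
  exact: leq_addr.
Qed.

Lemma ae_forall_int (Q : int -> Omega -> Prop) :
  (forall t, \forall w \ae P, Q t w) -> \forall w \ae P, forall t, Q t w.
Proof.
move=> H; have := ae_foralln (fun k : nat => H k%:Z).
have := ae_foralln (fun k : nat => H (Negz k)).
by apply: filterS2 => w Hn Hp [k|k].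
Qed.

End tightness.

Section uniqueness_and_stability.
Context {d : measure_display} {Omega : measurableType d} {R : realType}.
Variable P : probability Omega R.
Context {n : nat} {F T : metricType R} {h : 'M[R]_n -> F} {p : nat}.
Variables (Theta : set T) (dE : state p h -> state p h -> R).
Variable phi : int -> Omega -> state p h -> T -> state p h.
Variable Lam : nat -> int -> Omega -> T -> R.

Local Notation S := (orbit_space (map_cylinders Theta (p := p)) phi).

Hypothesis dE_product : product_metric dE.
Hypothesis dE_separable : dist_separable dE.
Hypothesis dE_complete : dist_complete dE.
Hypothesis Theta_compact : compact Theta.
Hypothesis phi_stationary : stationary P (map_cylinders Theta (p := p)) phi.
Hypothesis phi_ergodic : ergodic P (map_cylinders Theta (p := p)) phi.
Hypothesis phi_continuous : forall t w x j,
  {within Theta, continuous (fun theta => \val (phi t w x theta j) : F)}.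
Hypothesis phi_shift : forall t w x theta (i j : 'I_p), Theta theta ->
  nat_of_ord j = i.+1 -> phi t w x theta i = x j.
Hypothesis CI : cond_CI P Theta dE phi Lam.
Hypothesis p_gt0 : (0 < p)%N.

Let Lam_continuous := lip_continuous (CI_bounds CI).
Let Lam_bound := lip_bound (CI_bounds CI).

Variable y : state p h.
Hypothesis y_logmoment :
  (\int[P]_w ereal_sup [set logp (dE (phi 0%R w y theta) y) | theta in Theta]
    < +oo)%E.

Local Notation vol := (@volatility _ _ _ _ _ _ _ _ Theta dE phi y p_gt0).
Local Notation sol := (solution (Theta := Theta) dE (phi := phi) y).

Lemma contracting_ball_omega theta : Theta theta ->
  exists2 e, 0 < e & exists2 C, 0 < C & \forall w \ae P, forall t : int,
    contracting_at dE y (closed_ball_in Theta theta e) C ((t, w) : S).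
Proof.
move=> Ht; have [e e0 [C C0 H]] := contracting_ball dE_product dE_separable
  Theta_compact phi_stationary phi_ergodic phi_continuous CI y_logmoment Ht.
exists e => //; exists C => //; have := ae_orbit_law H.
by apply: filterS => w Hw t; have := Hw t 0; rewrite advance0.
Qed.

Lemma window_iterate (u : int -> img h) theta w (t0 : int) :
  (forall t, t0 + 1 <= t -> window u t = phi t w (window u (t - 1)) theta) ->
  forall k : nat, window u (t0 + k%:Z) =
    orbit_iter k theta ((t0 + k%:Z, w) : S) (window u t0).
Proof.
move=> H; elim=> [|k IH]; first by rewrite addr0.
have tk : t0 + k.+1%:Z - 1 = t0 + k%:Z by rewrite intS; ring.
rewrite H; last by rewrite lerD2l lez_nat.
by rewrite orbit_iterS /advance /= tk IH.
Qed.

Lemma img_open_far (u : img h) (c a : R) : 0 < c ->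
  @img_open _ _ _ h [set v | a < c * img_dist v u].
Proof.
move=> c0; exists [set v : F | a / c < mdist v (\val u)].
  rewrite openE => v /= av; apply/nbhs_ballP.
  exists (mdist v (\val u) - a / c); first by rewrite /= subr_gt0.
  move=> z; rewrite ballEmdist /= => vz.
  have := metric_triangle v z (\val u); lra.
by apply/seteqP; split=> v; rewrite /= ltr_pdivrMr // mulrC.
Qed.

Lemma stationary_distance_measurable (v : int -> Omega -> img h) t u :
  stationary P (@img_open _ _ _ h) v ->
  measurable_fun setT (fun w => img_dist (v t w) u).
Proof.
move=> [rv _]; apply: measurable_of_gt => a.
have := rv t _ (img_open_far u a ltr01).
rewrite [X in measurable X -> _](_ : _ = [set w | a < img_dist (v t w) u]) //.
by apply/seteqP; split=> w; rewrite /= mul1r.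
Qed.

Lemma stationary_marginal (v : int -> Omega -> img h) B t :
  stationary P (@img_open _ _ _ h) v -> img_open B ->
  P [set w | B (v t w)] = P [set w | B (v 0 w)].
Proof.
move=> [_ sv] oB.
have step i : P [set w | B (v i w)] = P [set w | B (v (i + 1) w)].
  apply: (sv [set z | B (z i)]); apply: sub_sigma_algebra; by exists i, B.
case: t => k.
  elim: k => [//|k IH]; rewrite -IH [RHS]step.
  by rewrite -addn1 PoszD.
elim: k => [|k IH]; first by rewrite step.
by rewrite -IH [LHS]step !NegzE [k.+2%:Z]intS opprD addrAC addNr add0r.
Qed.

Lemma window_tight (v : int -> Omega -> img h) t :
  stationary P (@img_open _ _ _ h) v ->
  tight P (fun k w => dE y (window (v ^~ w) (t - k%:Z))).
Proof.
move=> sv; have [c c0 Hc] := dE_le_sum dE_product.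
have mv t' u : measurable_fun setT (fun w => img_dist (v t' w) u).
  exact: stationary_distance_measurable.
apply: (tight_le (Z := fun k w => \sum_j c j *
    img_dist (v (t - k%:Z - p%:Z + 1 + (nat_of_ord j)%:Z) w) (y j))).
- move=> k; apply: (random_state_dE_cst dE_product
    (V := fun w => window (v ^~ w) (t - k%:Z))).
  by move=> j u; exact: mv.
- move=> k w; apply: (le_trans (Hc _ _)); apply: ler_sum => j _.
  by rewrite img_dist_sym.
apply: tight_sum => j.
apply: (tight_identical (Y0 := fun w => c j * img_dist (v 0 w) (y j))).
- by move=> k; apply: measurable_funM => //; exact: measurable_cst.
- by apply: measurable_funM => //; exact: measurable_cst.
- move=> k a; exact: (stationary_marginal _ sv (img_open_far (y j) a (c0 j))).
Qed.

(** The distance between two solutions at time [t] is at most the Lipschitz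
    coefficient of [k] steps times their distance at time [t - k]. The first
    factor vanishes, and for a stationary solution the second one stays
    bounded along infinitely many [k]. *)
Lemma stationary_solution_unique theta (v : int -> Omega ->
  img h) : Theta theta ->
  stationary_solution P phi theta v ->
  \forall w \ae P, forall t, v t w = vol t theta w.
Proof.
move=> Ht [sv rec]; have [e e0 [C C0 contr]] := contracting_ball_omega Ht.
have tightv := ae_forall_int (fun t => tight_recurrent (window_tight t sv)).
move: contr rec tightv; apply: filterS3 => w contr rec tightv t.
have KT : closed_ball_in Theta theta e `<=` Theta by exact: closed_ball_sub.
have Kt : closed_ball_in Theta theta e theta by exact: closed_ball_center.
have [[A A0 past] _ cauchy] := contr t; have [a Ha] := tightv t.
suff E : sol theta (t, w) = window (v ^~ w) t.
  by rewrite /volatility E window_last.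
apply: (dE_eq0 dE_product); apply/eqP; rewrite eq_le (dE_ge0 dE_product) andbT.
apply/ler_addgt0Pr => c cpos; rewrite add0r.
have c2 : 0 < c / 2 by rewrite divr_gt0.
have [n0 Hn0] := solution_cvg dE_product dE_complete cauchy Kt c2.
have [n1 Hn1] := exp_decay_small (A * `|a|) C0 c2.
have [k nk ka] := Ha (maxn n0 n1).
have {Hn0}Hn0 := Hn0 k (leq_trans (leq_maxl _ _) nk).
have {Hn1}Hn1 := Hn1 k (leq_trans (leq_maxr _ _) nk).
apply: (le_trans (dE_triangle dE_product _ (backward y k theta ((t,
  w) : S)) _)).
rewrite (dE_sym dE_product (sol theta _)) [leRHS]splitr.
apply: lerD; first exact: ltW.
have vE : window (v ^~ w) t = orbit_iter k theta ((t,
  w) : S) (window (v ^~ w) (t - k%:Z)).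
  have := @window_iterate (v ^~ w) theta w (t - k%:Z) (fun t _ => rec t) k.
  by rewrite subrK.
rewrite vE /backward; apply: ltW; apply: le_lt_trans Hn1.
apply: (le_trans (sup_lipP dE_product Theta_compact Lam_continuous Lam_bound KT
  _ _ _ _ Kt)).
rewrite mulrAC; apply: ler_pM.
- exact: (sup_lip_ge0 dE_product Theta_compact Lam_continuous Lam_bound KT).
- exact: dE_ge0.
- exact: past.
- exact: le_trans ka (ler_norm a).
Qed.

Lemma volatility_solution theta : Theta theta ->
  stationary_solution P phi theta (fun t => vol t theta).
Proof.
move=> Ht; split.
  apply: (factor_stationary phi_stationary
    (U := fun s : S => sol theta s (last_index p_gt0))) => B oB.
  apply: (random_state_open dE_product dE_separable (V := sol theta)) => //.
  exact: (solution_random_state dE_product dE_separable dE_complete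
    Theta_compact CI).
have [e e0 [C C0 contr]] := contracting_ball_omega Ht.
move: contr; apply: filterS => w contr.
have Kt : closed_ball_in Theta theta e theta by exact: closed_ball_center.
have cv (t : int) : converges dE (fun k =>
  backward y k theta ((t, w) : S)) (sol theta (t, w)).
  exact: (solution_cvg dE_product dE_complete (contracting_cauchy (contr t))
    Kt).
exact: (window_volatility dE_product Theta_compact phi_shift CI p_gt0 Ht cv).2.
Qed.

Lemma volatility_continuous : \forall w \ae P, forall t,
  {within Theta, continuous (fun theta => \val (vol t theta w) : F)}.
Proof.
(* Each ball has its own null set; by compactness, finitely many suffice. *)
pose cont_at w t theta := forall c, 0 < c -> exists2 r, 0 < r &
  forall theta', Theta theta' -> mdist theta theta' < r ->
    dE (sol theta (t, w)) (sol theta' (t, w)) < c.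
pose Q (A : set T) := \forall w \ae P, forall t theta, (Theta `&` A) theta ->
  cont_at w t theta.
have QT : Q Theta.
  apply: (compact_induction (Q := Q) Theta_compact).
  - by apply: aeW => w t theta [].
  - move=> A B AB; rewrite /Q; apply: filterS => w H t theta [Ht At];
      apply: H; split=> //.
    exact: AB.
  - move=> A B; rewrite /Q; apply: filterS2 => w HA HB t theta [Ht [At|Bt]].
      exact: HA.
    exact: HB.
  - move=> theta Ht; have [e e0 [C C0 contr]] := contracting_ball_omega Ht.
    exists (ball theta e); first exact: nbhsx_ballx.
    move: contr; apply: filterS => w contr t theta' [Ht' [_]].
    rewrite ballEmdist /= => tt'.
    exact: (solution_continuous dE_product dE_complete Theta_compact
      phi_continuous CI (contracting_cauchy (contr t)) Ht' tt').
move: QT; rewrite /Q; apply: filterS => w Hw t;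
  apply: dist_within_continuous => theta Ht c c0.
have [D D0 HD] := img_dist_le_dE dE_product.
have [r r0 Hr] := Hw t theta (conj Ht Ht) _ (divr_gt0 c0 D0).
exists r => // theta' Ht' /(Hr _ Ht') H; rewrite ballEmdist /=.
by apply: (le_lt_trans (HD _ _ _)); rewrite mulrC -ltr_pdivlMr.
Qed.

(** Both sequences are images of their values at time [0] under the same maps,
    and the initial distance is bounded over the ball. *)
Lemma approx_recursion_eas theta : Theta theta -> exists2 e : R, 0 < e &
  forall ghat : int -> T -> Omega -> img h,
    approx_recursion P dE phi (closed_ball_in Theta theta e) ghat ->
    eas_to0 P (fun (t : nat) (w : Omega) =>
      ereal_sup [set (img_dist (ghat t%:Z theta' w) (vol t%:Z theta' w))%:E |
                 theta' in closed_ball_in Theta theta e]).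
Proof.
move=> Ht; have [e e0 [C C0 contr]] := contracting_ball_omega Ht.
exists e => // ghat [rec init]; pose K := closed_ball_in Theta theta e.
have KT : K `<=` Theta by exact: closed_ball_sub.
have Kt : K theta by exact: closed_ball_center.
have [D D0 HD] := img_dist_le_dE dE_product.
(* The error is [O(exp (- C t))], hence [o(exp (- C t / 2))]. *)
exists (C / 2); first by rewrite divr_gt0.
move: contr rec init; apply: filterS3 => w contr rec [y1 [m Hm]].
have [_ [A A0 future] cauchy] := contr 0.
have [B [c [B0 c0 HB]]] := solution_exp_cvg dE_product dE_complete cauchy.
pose I := `|m| + dE y1 y + B.
have I0 : 0 <= I by rewrite !addr_ge0 ?normr_ge0 ?(dE_ge0 dE_product).
have bound (t : nat) theta' : K theta' ->
    img_dist (ghat t%:Z theta' w) (vol t%:Z theta' w) <=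
    D * (A * I) * expR (- (C * t%:R)).
  move=> Kt'; have Ht' := KT _ Kt'.
  have cv (i : int) : converges dE (fun k =>
    backward y k theta' ((i, w) : S)) (sol theta' (i, w)).
    exact: (solution_cvg dE_product dE_complete (contracting_cauchy (contr i))
      Kt').
  have [volE volrec] := window_volatility dE_product Theta_compact phi_shift CI
    p_gt0 Ht' cv.
  rewrite -(window_last p_gt0 (fun k => ghat k theta' w)).
  rewrite -(window_last p_gt0 (fun k => vol k theta' w)).
  apply: (le_trans (HD _ _ _)); rewrite -mulrA; apply: ler_wpM2l;
    first exact: ltW.
  have E1 := @window_iterate (fun k => ghat k theta' w) theta' w 0
    (fun i Hi => rec i Hi _ Kt') t.
  have E2 := @window_iterate (fun k => vol k theta' w) theta' w 0
    (fun i _ => volrec i) t.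
  rewrite add0r in E1 E2; rewrite E1 E2.
  apply: (le_trans (sup_lipP dE_product Theta_compact Lam_continuous Lam_bound
    KT _ _ _ _ Kt')).
  rewrite mulrAC; apply: ler_pM.
  - exact: (sup_lip_ge0 dE_product Theta_compact Lam_continuous Lam_bound KT).
  - exact: dE_ge0.
  - by have := future t; rewrite /advance /= add0r.
  - rewrite volE; apply: (le_trans (dE_triangle dE_product _ y1 _)).
    rewrite /I -addrA; apply: lerD.
      by rewrite (dE_sym dE_product); apply: (le_trans (Hm _ Kt'));
        exact: ler_norm.
    apply: (le_trans (dE_triangle dE_product _ y _)); rewrite lerD2l.
    by have := HB theta' 0%N Kt'; rewrite mulr0 oppr0 expR0 mulr1.
pose J := D * (A * I); have C2 : 0 < C / 2 by rewrite divr_gt0.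
apply: (@squeeze_cvge _ _ _ _ (fun=> 0%E) _ (fun t : nat =>
  (J * expR (- (C / 2 * t%:R)))%:E)).
- apply: nearW => t; apply/andP; split.
    apply: mule_ge0; first by rewrite lee_fin expR_ge0.
    apply: (@le_trans _ _ (img_dist (ghat t%:Z theta w) (vol t%:Z theta w))%:E).
      by rewrite lee_fin img_dist_ge0.
    by apply: ereal_sup_ubound; exists theta.
  apply: (@le_trans _ _ ((expR (C / 2 * t%:R))%:E * (J * expR (- (C *
    t%:R)))%:E)%E).
    apply: lee_wpmul2l; first by rewrite lee_fin expR_ge0.
    by apply: ge_ereal_sup => _ [theta' Kt' <-]; rewrite lee_fin; exact: bound.
  rewrite -EFinM lee_fin mulrCA -expRD.
  by rewrite le_eqVlt; apply/orP; left; apply/eqP; congr (_ * expR _); field.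
- exact: cvg_cst.
- apply/fine_cvgP; split; first exact: nearW.
  apply/cvgrPdist_lt => eps eps0; have [n0 Hn0] := exp_decay_small J C2 eps0.
  exists n0 => // t /Hn0; rewrite /= sub0r normrN ger0_norm //.
  by rewrite mulr_ge0 ?expR_ge0 // mulr_ge0 ?(ltW D0) // mulr_ge0.
Qed.

End uniqueness_and_stability.

(** * Existence, continuity and stability of the stationary solution *)

Theorem theorem3 (d : measure_display) (Omega : measurableType d)
    (R : realType) (P : probability Omega R)
    (n p q : nat) (F T : metricType R)
    (h : 'M[R]_n -> F) (Theta : set T) (theta0 : T)
    (dE : state p h -> state p h -> R)
    (Z X : int -> Omega -> 'cV[R]_n) (Sigma : int -> Omega -> 'M[R]_n)
    (psi : int -> Omega -> (nat -> img h) -> T -> (nat -> img h))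
    (phi : int -> Omega -> state p h -> T -> state p h)
    (Lam : nat -> int -> Omega -> T -> R) :
  (0 < n)%N -> (0 < p)%N ->
  separable F -> injective h ->
  product_metric dE -> dist_complete dE -> dist_separable dE ->
  compact Theta -> Theta theta0 ->
  volatility_model P Theta theta0 Z X Sigma psi ->
  lag_model P Theta q theta0 X Sigma phi ->
  cond_ST P dE Z X Sigma ->
  cond_CI P Theta dE phi Lam ->
  exists g : int -> T -> Omega -> img h,
    [/\ forall theta, Theta theta ->
          unique_stationary_solution P phi theta (fun t => g t theta),
        \forall w \ae P, forall t,
          {within Theta, continuous (fun theta => \val (g t theta w) : F)} &
        forall theta, Theta theta ->
          exists2 e : R, 0 < e &
            forall ghat : int -> T -> Omega -> img h,
              approx_recursion P dE phi (closed_ball_in Theta theta e) ghat ->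
              eas_to0 P (fun (t : nat) (w : Omega) =>
                ereal_sup [set (img_dist (ghat t%:Z theta' w)
                                         (g t%:Z theta' w))%:E |
                           theta' in closed_ball_in Theta theta e])].
Proof.
move=> n_gt0 p_gt0 F_sep h_inj dE_product dE_complete dE_separable
  Theta_compact.
move=> Theta_theta0 _ lag _ CI.
have phi_stationary := lag_maps_stationary lag.
have phi_ergodic := lag_maps_ergodic lag.
have phi_continuous := lag_maps_continuous lag.
have phi_shift := lag_maps_shift lag.
have [y y_logmoment] := CI_logmoment CI.
exists (volatility Theta dE phi y p_gt0); split.
- move=> theta Ht; split.
    exact: (volatility_solution dE_product dE_separable dE_complete
      Theta_compact
      phi_stationary phi_ergodic phi_continuous phi_shift CI p_gt0 y_logmoment
        Ht).
  move=> v; exact: (stationary_solution_unique dE_product dE_separable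
    dE_complete
    Theta_compact phi_stationary phi_ergodic phi_continuous CI p_gt0
      y_logmoment Ht).
- exact: (volatility_continuous dE_product dE_separable dE_complete
    Theta_compact
    phi_stationary phi_ergodic phi_continuous CI p_gt0 y_logmoment).
- move=> theta Ht.
  exact: (approx_recursion_eas dE_product dE_separable dE_complete Theta_compact
    phi_stationary phi_ergodic phi_continuous phi_shift CI p_gt0 y_logmoment
      Ht).
Qed.
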